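(* Let $E$ be a Banach space such that $\overline{\mathcal{E}(B(E^* ))} \nsubseteq \partial B(E^* )$, the closure being taken in the weak$^*$ topology. Then the only isolated types over $E$ are the realised ones, i.e., for every $n$ a type in $S_n(E)$ is isolated if and only if it is realised by a tuple of $E$. This holds in particular when $E = c_0$, or $E = \ell_p$ with $1 < p < \infty$.
   Context: All spaces are real. $E^*$ is the dual of $E$, equipped with the weak$^*$ topology; $B(E^* ) = \{\lambda \in E^* : \|\lambda\| \leq 1\}$, $\partial B(E^* ) = \{\lambda \in E^*: \|\lambda\| = 1\}$, and $\mathcal{E}(B(E^* ))$ is the set of extreme points of $B(E^* )$. Types. For a Banach space $E$ and $n \in \mathbb{N}$, let $E(n) = E \oplus \bigoplus_{i<n} \mathbb{R} x_i$, with formal variables $x_i$. The space of $n$-types $S_n(E)$ is the set of all semi-norms on $E(n)$ extending the norm of $E$; the semi-norm corresponding to $\xi \in S_n(E)$ is written $\|\cdot\|^\xi$. If $E \subseteq F$ are Banach spaces (isometric inclusion) and $\bar a \in F^n$, then $\mathrm{tp}(\bar a/E) \in S_n(E)$ is the semi-norm $b + \sum \lambda_i x_i \mapsto \| b + \sum \lambda_i a_i \|$; $\bar a$ realises $\xi$ if $\xi = \mathrm{tp}(\bar a/E)$. The topology on $S_n(E)$ is the least one making $\xi \mapsto \|x\|^\xi$ continuous for every $x \in E(n)$. The distance $d(\xi,\zeta)$ is the infimum, over all Banach spaces $F \supseteq E$ and all realisations $\bar a,\bar b \in F^n$ of $\xi,\zeta$ respectively, of $\sup_i \|a_i - b_i\|$.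 A type $\xi$ is isolated if every metric neighbourhood of $\xi$ is also a neighbourhood of $\xi$ in the topology.
   Formalization: The Banach space E is assumed nonzero: for E = {0} the hypothesis on extreme points holds (the unit sphere of the dual is empty) and every type is isolated, yet the 1-type with norm 1 at x_0 is not realised. *)

(* Defs.v *)
From HB Require Import structures.
From mathcomp Require Import all_boot all_order all_algebra.
From mathcomp Require Import all_classical all_reals all_analysis.

Set Implicit Arguments.
Unset Strict Implicit.
Unset Printing Implicit Defensive.

Import Order.TTheory GRing.Theory Num.Theory.
Import numFieldNormedType.Exports.

Local Open Scope classical_set_scope.
Local Open Scope ring_scope.

Section dual_space.
Context {R : realType} (E : normedModType R).

Definition continuous_linear_form : {pred E -> R} :=
  mem [set f : E -> R | linear (f : E -> R^o) /\ continuous f].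

Record dual := Dual {
  dual_fun :> E -> R;
  dual_funP : dual_fun \in continuous_linear_form }.

HB.instance Definition _ := [isSub for dual_fun].
HB.instance Definition _ := [Choice of dual by <:].

Lemma continuous_linear_form_submod : submod_closed continuous_linear_form.
Proof.
split.
  rewrite inE; split; last by move=> x; exact: cvg_cst.
  by move=> a x y; rewrite /= scaler0 addr0.
move=> a f g; rewrite !inE => -[lf cf] [lg cg]; split; last first.
  by move=> x; apply: cvgD; [apply: cvgZl_tmp; exact: cf|exact: cg].
move=> b x y; rewrite /= (_ : (a *: f + g) = fun z => a * f z + g z)//.
rewrite lf lg /= /GRing.scale /=.
by rewrite !mulrDr mulrCA addrACA.
Qed.

HB.instance Definition _ :=
  GRing.isSubmodClosed.Build _ _ continuous_linear_form
    continuous_linear_form_submod.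
HB.instance Definition _ := [SubChoice_isSubLmodule of dual by <:].

(* [dual] carries the weak-star topology, not the one given by [dual_norm]. *)
HB.instance Definition _ := Topological.copy dual
  (initial_topology (dual_fun : dual -> {ptws E -> R})).

Definition dual_norm (f : dual) : R :=
  sup [set `|f x| | x in [set x : E | `|x| <= 1]].

Definition dual_ball : set dual := [set f | dual_norm f <= 1].

Definition dual_sphere : set dual := [set f | dual_norm f = 1].

End dual_space.

Definition extreme_points {R : realType} {V : lmodType R} (A : set V) : set V :=
  [set x | A x /\ forall (y z : V) (t : R), A y -> A z -> 0 < t < 1 ->
    x = t *: y + (1 - t) *: z -> y = x /\ z = x].

Record isometric_embedding {R : realType} (E F : normedModType R) :=
  IsometricEmbedding {
    iso_fun :> {linear E -> F};
    iso_norm : forall x, `|iso_fun x| = `|x| }.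

Definition iso_id {R : realType} (E : normedModType R) :
    isometric_embedding E E :=
  @IsometricEmbedding R E E idfun (fun=> erefl).

Section types.
Context {R : realType}.

(* The pair [(b, l)] stands for [b + \sum_i l_i x_i]. *)
Definition formal_extension (E : normedModType R) (n : nat) : lmodType R :=
  (E * 'rV[R]_n)%type.

Definition seminorm_extending (E : normedModType R) (n : nat)
    (N : formal_extension E n -> R) : Prop :=
  [/\ forall x y, N (x + y) <= N x + N y,
      forall a x, N (a *: x) = `|a| * N x &
      forall b : E, N (b, 0) = `|b| ].

Record ntype (E : normedModType R) (n : nat) := NType {
  type_norm :> formal_extension E n -> R;
  type_normP : `[< seminorm_extending type_norm >] }.

HB.instance Definition _ E n := [isSub for @type_norm E n].
HB.instance Definition _ E n := [Choice of ntype E n by <:].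

(* Initial topology for the evaluations [xi |-> xi x], with [x] in
   [formal_extension E n]. *)
HB.instance Definition _ E n := Topological.copy (ntype E n)
  (initial_topology
     (@type_norm E n : ntype E n -> {ptws formal_extension E n -> R})).

Definition tp_fun (E F : normedModType R) (j : isometric_embedding E F)
    (n : nat) (a : 'I_n -> F) (x : formal_extension E n) : R :=
  `|j x.1 + \sum_(i < n) x.2 0 i *: a i|.

Lemma tp_funP (E F : normedModType R) (j : isometric_embedding E F)
  (n : nat) (a : 'I_n -> F) : `[< seminorm_extending (tp_fun j a) >].
Proof.
apply/asboolP; split.
- move=> x y; rewrite /tp_fun /= linearD.
  under eq_bigr do rewrite mxE scalerDl.
  by rewrite big_split/= addrACA ler_normD.
- move=> c x; rewrite /tp_fun /= linearZ.
  under eq_bigr do rewrite mxE -scalerA.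
  by rewrite -scaler_sumr -scalerDr normrZ.
- move=> b; rewrite /tp_fun /= big1 ?addr0 ?iso_norm// => i _.
  by rewrite mxE scale0r.
Qed.

Definition tp (E F : normedModType R) (j : isometric_embedding E F)
  (n : nat) (a : 'I_n -> F) : ntype E n := NType (tp_funP j a).

(* The set below is bounded below by 0, and nonempty because two Banach
   extensions of [E] can always be amalgamated over [E]. *)
Definition type_dist (E : normedModType R) (n : nat) (xi zeta : ntype E n) : R :=
  inf [set r | exists (F : completeNormedModType R)
                      (j : isometric_embedding E F) (a b : 'I_n -> F),
    [/\ tp j a = xi, tp j b = zeta &
        r = \big[Num.max/0]_(i < n) `|a i - b i|]].

Definition isolated_type (E : normedModType R) (n : nat) (xi : ntype E n) :=
  forall U : set (ntype E n),
    (exists2 e : R, 0 < e & [set zeta | type_dist xi zeta < e] `<=` U) ->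
    nbhs xi U.

Definition realised_type (E : normedModType R) (n : nat) (xi : ntype E n) :=
  exists a : 'I_n -> E, tp (iso_id E) a = xi.

Definition only_realised_types_isolated (E : normedModType R) :=
  forall (n : nat) (xi : ntype E n), isolated_type xi <-> realised_type xi.

End types.

Section c0.
Context (R : realType).

Definition vanishing_seq : {pred nat -> R} :=
  mem [set u : nat -> R | u @ \oo --> 0].

Record c0 := C0 { c0_seq :> nat -> R; c0_seqP : c0_seq \in vanishing_seq }.

HB.instance Definition _ := [isSub for c0_seq].
HB.instance Definition _ := [Choice of c0 by <:].

Lemma vanishing_seq_submod : submod_closed vanishing_seq.
Proof.
split; first by rewrite inE; exact: cvg_cst.
move=> a f g; rewrite !inE => f0 g0; rewrite /= -[0](addr0) -{1}(mulr0 a).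
by apply: cvgD => //; exact: cvgMl_tmp.
Qed.

HB.instance Definition _ :=
  GRing.isSubmodClosed.Build _ _ vanishing_seq vanishing_seq_submod.
HB.instance Definition _ := [SubChoice_isSubLmodule of c0 by <:].

Definition c0_norm (u : c0) : R := sup (range (fun n => `|u n|)).

Lemma c0_has_sup (u : c0) : has_sup (range (fun n => `|u n|)).
Proof.
split; first by exists `|u 0%N|; exists 0%N.
have /set_mem/= u0 := c0_seqP u.
have : cvgn (u : nat -> R) by apply/cvg_ex; exists 0.
move=> /cvg_seq_bounded[M [_ /(_ (M + 1))]].
rewrite ltrDl ltr01 => /(_ isT) uM.
by exists (M + 1) => _ [n _ <-]; exact: uM.
Qed.

Lemma c0_norm_ub (u : c0) n : `|u n| <= c0_norm u.
Proof. by apply: (sup_upper_bound (c0_has_sup u)); exists n. Qed.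

Lemma c0_norm_le (u : c0) e : (forall n, `|u n| <= e) -> c0_norm u <= e.
Proof.
move=> ue; apply: ge_sup; first by case: (c0_has_sup u).
by move=> _ [n _ <-].
Qed.

Lemma c0_normD u v : c0_norm (u + v) <= c0_norm u + c0_norm v.
Proof.
apply: c0_norm_le => n; apply: (le_trans (ler_normD _ _)).
by apply: lerD; exact: c0_norm_ub.
Qed.

Lemma c0_normZ (a : R) u : c0_norm (a *: u) = `|a| * c0_norm u.
Proof.
have le b v : c0_norm (b *: v) <= `|b| * c0_norm v.
  by apply: c0_norm_le => n; rewrite normrM ler_wpM2l// c0_norm_ub.
apply/eqP; rewrite eq_le le/=.
have [->|a0] := eqVneq a 0.
  by rewrite normr0 mul0r (le_trans _ (c0_norm_ub _ 0%N)).
rewrite -ler_pdivlMl ?normr_gt0// -[in leLHS](scalerK a0 u) -normfV.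
exact: le.
Qed.

Lemma c0_norm_eq0 u : c0_norm u = 0 -> u = 0.
Proof.
move=> u0; apply/val_inj/funext => n /=; apply/eqP.
by rewrite -normr_le0 -u0 c0_norm_ub.
Qed.

HB.instance Definition _ :=
  @Lmodule_isNormed.Build R c0 c0_norm c0_normD c0_normZ c0_norm_eq0.

Lemma c0_normE (u : c0) : `|u| = sup (range (fun n => `|u n|)).
Proof. by []. Qed.

Lemma c0_complete (F : set_system c0) : ProperFilter F -> cauchy F -> cvg F.
Proof.
move=> FF Fc.
have Fe e : 0 < e -> exists w : c0, \forall u \near F, `|w - u| <= e.
  move=> e0; have /cauchyP/(_ _ e0)[w Fw] := Fc.
  exists w; apply: filterS Fw => u; rewrite -ball_normE/= => /ltW.
  by [].
have Fn n : cvg ((fun u : c0 => u n) @ F).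
  apply/cauchy_cvgP/cauchy_exP => e e0.
  have [|w Fw] := Fe (e / 2); first by rewrite divr_gt0.
  exists (w n); suff : \forall u \near F, ball (w n) e ((u : c0) n) by [].
  apply: filterS Fw => u; rewrite -ball_normE/=.
  move=> /(le_trans (c0_norm_ub (w - u) n))/= /le_lt_trans; apply.
  by rewrite ltr_pdivrMr// ltr_pMr// ltr1n.
pose x n := lim ((fun u : c0 => u n) @ F).
have xw (w : c0) e : (\forall u \near F, `|w - u| <= e) ->
    forall n, `|w n - x n| <= e.
  move=> Fw n.
  apply: (@closed_cvg _ _ F _ (fun u : c0 => `|w n - u n|) [set y | y <= e]).
  - exact: closed_le.
  - by apply: filterS Fw => u; apply: le_trans; exact: (c0_norm_ub (w - u)).
  - by apply: cvg_norm; apply: cvgB; [exact: cvg_cst|exact: Fn].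
have x0 : x \in vanishing_seq.
  rewrite inE /=; apply/cvgrPdist_le => e e0.
  have [|w Fw] := Fe (e / 2); first by rewrite divr_gt0.
  have /set_mem/= w0 := c0_seqP w.
  near=> n; rewrite sub0r normrN.
  rewrite -(subrK (w n) (x n)) (le_trans (ler_normD _ _))//.
  rewrite (splitr e) lerD//; first by rewrite distrC; exact: xw.
  by near: n; move/cvgr0Pnorm_le : w0; apply; rewrite divr_gt0.
apply/cvg_ex; exists (C0 x0); apply/cvgrPdist_le => e e0.
have [|w Fw] := Fe (e / 2); first by rewrite divr_gt0.
near=> u.
rewrite -(subrK w (C0 x0)) -addrA (le_trans (ler_normD _ _))//.
rewrite (splitr e) lerD//; last by near: u.
by rewrite distrC; apply: c0_norm_le => n; exact: xw.
Unshelve. all: by end_near. Qed.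

HB.instance Definition _ := Uniform_isComplete.Build c0 c0_complete.

End c0.

Section lp.
Context (R : realType) (p : R) (p1 : 1 <= p).

Definition lp := LfunType (@counting nat R) (p1 : (1 <= p%:E)%E).

HB.instance Definition _ := GRing.Lmodule.on lp.

Definition lp_norm (u : lp) : R := fine ('N[counting]_p%:E[EFin \o u])%E.

Lemma lp_normZ (a : R) (u : lp) : lp_norm (a *: u) = `|a| * lp_norm u.
Proof.
by apply: EFin_inj; rewrite EFinM !finite_norm_fine -LnormZ.
Qed.

Let p0 : 0 < p. Proof. exact: lt_le_trans p1. Qed.

Lemma Lnorm_counting_leP (f : nat -> R) (e : R) : 0 <= e ->
  ('N[counting]_p%:E[EFin \o f] <= e%:E)%E <->
  (forall n, \sum_(0 <= k < n) `|f k| `^ p <= e `^ p).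
Proof.
move=> e0; have sumE n : (\sum_(0 <= k < n) (`|f k| `^ p)%:E)%E =
   (\sum_(0 <= k < n) `|f k| `^ p)%:E :> \bar R by rewrite sumEFin.
have N_ge0 : (0 <= 'N[counting]_p%:E[EFin \o f])%E by exact: Lnorm_ge0.
have NE : ('N[counting]_p%:E[EFin \o f] =
    (\sum_(k <oo) (`|f k| `^ p)%:E) `^ p^-1)%E by rewrite Lnorm_counting.
have sum_ge0 : (0 <= \sum_(k <oo) (`|f k| `^ p)%:E)%E.
  by apply: nneseries_ge0 => k _ _; rewrite lee_fin powR_ge0.
have NpE : (\sum_(k <oo) (`|f k| `^ p)%:E =
    'N[counting]_p%:E[EFin \o f] `^ p)%E.
  by rewrite NE -poweRrM mulVf ?gt_eqF// poweRe1.
split=> [Ne n|le].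
  rewrite -lee_fin -sumE; apply: (@le_trans _ _ (\sum_(k <oo) (`|f k| `^ p)%:E)%E).
    by apply: nneseries_lim_ge => k _ _; rewrite lee_fin powR_ge0.
  rewrite NpE -poweR_EFin; apply: gt0_ler_poweR => //; first exact: ltW.
    by rewrite in_itv/= N_ge0 leey.
  by rewrite in_itv/= leey lee_fin e0.
have -> : e%:E = ((e `^ p)%:E `^ p^-1)%E.
  by rewrite poweR_EFin -powRrM mulfV ?gt_eqF// powRr1.
rewrite NE; apply: gt0_ler_poweR; first by rewrite invr_ge0 ltW.
- by rewrite in_itv/= sum_ge0 leey.
- by rewrite in_itv/= leey lee_fin powR_ge0.
apply: lime_le.
  by apply: is_cvg_nneseries => k _ _; rewrite lee_fin powR_ge0.
by apply: nearW => n; rewrite sumE lee_fin.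
Qed.

Lemma lp_norm_ge0 (u : lp) : 0 <= lp_norm u.
Proof. by rewrite fine_ge0// Lnorm_ge0. Qed.

Lemma lp_norm_leP (u : lp) (e : R) : 0 <= e -> lp_norm u <= e <->
  (forall n, \sum_(0 <= k < n) `|u k| `^ p <= e `^ p).
Proof.
by move=> e0; rewrite -Lnorm_counting_leP// -lee_fin finite_norm_fine.
Qed.

Lemma lp_norm_ub (u : lp) n : `|u n| <= lp_norm u.
Proof.
have /(lp_norm_leP u (lp_norm_ge0 u))/(_ n.+1) := lexx (lp_norm u).
rewrite big_nat_recr//= => le.
have : `|u n| `^ p <= lp_norm u `^ p.
  by apply: le_trans le; rewrite lerDr sumr_ge0// => k _; exact: powR_ge0.
rewrite !leNgt; apply: contra => /(gt0_ltr_powR p0); apply.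
  by rewrite nnegrE lp_norm_ge0.
by rewrite nnegrE.
Qed.

Lemma lp_norm_eq0 (u : lp) : lp_norm u = 0 -> u = 0.
Proof.
move=> u0; apply/LfuneqP => n; apply/eqP.
by rewrite -normr_le0 -u0 lp_norm_ub.
Qed.

HB.instance Definition _ :=
  @Lmodule_isNormed.Build R lp lp_norm (@ler_LnormD _ _ _ _ _ _)
    lp_normZ lp_norm_eq0.

Lemma lp_normE (u : lp) :
  `|u| = fine ((\sum_(k <oo) (`|u k| `^ p)%:E) `^ p^-1)%E.
Proof. by rewrite -[LHS]/(fine _) Lnorm_counting. Qed.

Lemma continuous_norm_powR : continuous (fun y : R => `|y| `^ p).
Proof.
move=> y; have [->|y0] := eqVneq y 0.
  rewrite /continuous_at normr0 powR0 ?gt_eqF//; apply/cvgr0Pnorm_le => e e0.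
  near=> z; rewrite ger0_norm ?powR_ge0//.
  have -> : e = (e `^ p^-1) `^ p by rewrite -powRrM mulVf ?gt_eqF// powRr1// ltW.
  apply: (ge0_ler_powR (ltW p0)); rewrite ?nnegrE ?powR_ge0//.
  near: z; have := @cvg_id _ (nbhs (0 : R)) => /cvgr0Pnorm_le; apply.
  by rewrite powR_gt0.
apply: (@cvg_comp _ _ _ (fun z : R => `|z|) (fun z : R => z `^ p) _ (nbhs `|y|)).
  exact: norm_continuous.
apply: (@differentiable_continuous _ R^o R^o `|y| (fun z : R => z `^ p)).
apply/derivable1_diffP.
by apply: derivable_powR; rewrite in_itv/= normr_gt0 y0.
Unshelve. all: by end_near. Qed.

Lemma lp_complete (F : set_system lp) : ProperFilter F -> cauchy F -> cvg F.
Proof.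
move=> FF Fc.
have Fe e : 0 < e -> exists w : lp, \forall u \near F, `|w - u| <= e.
  move=> e0; have /cauchyP/(_ _ e0)[w Fw] := Fc.
  exists w; apply: filterS Fw => u; rewrite -ball_normE/= => /ltW.
  by [].
have Fn n : cvg ((fun u : lp => u n) @ F).
  apply/cauchy_cvgP/cauchy_exP => e e0.
  have [|w Fw] := Fe (e / 2); first by rewrite divr_gt0.
  exists (w n); suff : \forall u \near F, ball (w n) e ((u : lp) n) by [].
  apply: filterS Fw => u; rewrite -ball_normE/=.
  move=> /(le_trans (lp_norm_ub (w - u) n))/= /le_lt_trans; apply.
  by rewrite ltr_pdivrMr// ltr_pMr// ltr1n.
pose x (n : nat) : R := lim ((fun u : lp => u n) @ F).
have xw (w : lp) e : 0 <= e -> (\forall u \near F, `|w - u| <= e) ->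
    ('N[counting]_p%:E[EFin \o (fun n => w n - x n)%R] <= e%:E)%E.
  move=> e0 Fw; apply/Lnorm_counting_leP => // n.
  apply: (@closed_cvg _ _ F _
    (fun u : lp => \sum_(0 <= k < n) `|w k - u k| `^ p)
    [set y | y <= e `^ p]).
  - exact: closed_le.
  - by apply: filterS Fw => u /(lp_norm_leP (w - u) e0)/(_ n).
  - apply: cvg_big => [|k _]; first exact: add_continuous.
    apply: (@cvg_comp _ _ _ (fun u : lp => w k - u k)
             (fun y : R => `|y| `^ p)); last exact: continuous_norm_powR.
    by apply: cvgB; [exact: cvg_cst|exact: Fn].
have [w1 Fw1] := Fe 1 ltr01.
have wx : (fun n => w1 n - x n) \in Lfun (@counting nat R) p%:E.
  rewrite inE/=; apply/andP; split; first by rewrite inE.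
  by rewrite inE/= /finite_norm (le_lt_trans (xw w1 1 ler01 Fw1))// ltry.
pose l : lp := w1 - (Lfun_Sub (p1 : (1 <= p%:E)%E) wx : lp).
have lE n : l n = x n by rewrite /l /= opprB addrC subrK.
have lw (w : lp) e : 0 <= e -> (\forall u \near F, `|w - u| <= e) ->
    `|w - l| <= e.
  move=> e0 /(xw _ _ e0); rewrite -lee_fin finite_norm_fine.
  congr (_ <= _)%E; apply: eq_Lnorm => n /=.
  by congr (_%:E); rewrite -lE.
apply/cvg_ex; exists l; apply/cvgrPdist_le => e e0.
have [|w Fw] := Fe (e / 2); first by rewrite divr_gt0.
near=> u.
rewrite -(subrK w l) -addrA (le_trans (ler_normD _ _))//.
rewrite (splitr e) lerD//; last by near: u.
by rewrite distrC; apply: lw => //; rewrite divr_ge0// ltW.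
Unshelve. all: by end_near. Qed.

HB.instance Definition _ := Uniform_isComplete.Build lp lp_complete.

End lp.

(* Main.v *)
From HB Require Import structures.
Require Import Defs.
From mathcomp Require Import all_boot all_order all_algebra.
From mathcomp Require Import all_classical all_reals all_analysis.
From mathcomp Require Import ring lra.

(** Write [K(xi)] for the set of linear forms on [E(n)] dominated by the type
    [xi]. By the Hahn-Banach theorem [xi] is the supremum of [K(xi)], and
    restriction to [E] maps [K(xi)] onto the dual ball. Closeness of types in
    the topology is closeness of these suprema at finitely many vectors,
    whereas if [xi] and [zeta] are at distance less than [e], then every form
    of [K(xi)] has a companion in [K(zeta)] with the same restriction to [E]
    and values at the variables less than [e] away ([type_dist_transfer]).

    A realised type is isolated for a direct reason ([realised_isolated]).
    Conversely, let [lambda] be a weak-star limit of extreme points of the dual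
    ball, of norm [r < 1], and let [xi] be isolated but not realised. As [E] is
    complete, some variable [x_i] is at positive distance from [E]
    ([not_realised_dist]), so there is a nonzero form below this distance,
    vanishing on [E]. Since [lambda] has norm less than 1, adding and
    subtracting a multiple of it gives two extensions of [lambda] in [K(xi)]
    with distinct values [s] and [s'] at [x_i].

    Isolation is then used twice. First, enlarging [K(xi)] by one form shows
    that every form [mu] of the dual ball close to [lambda] has extensions in
    [K(xi)] with values at [x_i] close to [s] and to [s']
    ([isolated_extension_near]). Next, let [mu] be moreover an extreme point,
    distinct from the restrictions of finitely many forms that norm the given
    test vectors; such [mu] exist because they have norm 1 and accumulate at
    [lambda]. Removing from [K(xi)] the forms over a slice around [mu] whose
    value at [x_i] is not close to [s], together with their opposites, does
    not affect the test vectors, and leaves over [mu] only values close to [s]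
    ([concentrated_type]). The new
    type is close to [xi] in the topology, but no longer has a form over [mu]
    with value near [s'], so it is far from [xi] in the metric.

    In [c0] and in [lp] with [1 < p], the coordinate functionals are extreme
    points of the dual ball and converge weak-star to 0. *)

Set Implicit Arguments.
Unset Strict Implicit.
Unset Printing Implicit Defensive.

Import Order.TTheory GRing.Theory Num.Theory.
Import numFieldNormedType.Exports.
Local Open Scope classical_set_scope.
Local Open Scope ring_scope.

(** * Sublinear functionals and the Hahn-Banach theorem *)

Definition linear_of {R : realType} (U V : lmodType R) (f : U -> V)
    (lf : linear f) : {linear U -> V} :=
  HB.pack_for {linear U -> V} f (GRing.isLinear.Build R U V *:%R f lf).

Section sublinear.
Context {R : realType}.

Lemma le_inf_add (A B : set R) (c : R) : A !=set0 -> B !=set0 ->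
  (forall a b, A a -> B b -> c <= a + b) -> c <= inf A + inf B.
Proof.
move=> A0 B0 cAB; rewrite -lerBlDl; apply: lb_le_inf => // b Bb.
rewrite lerBlDl -lerBlDr; apply: lb_le_inf => // a Aa.
by rewrite lerBlDr cAB.
Qed.

Definition sublinear (V : lmodType R) (p : V -> R) :=
  (forall x y, p (x + y) <= p x + p y) /\
  (forall a x, 0 <= a -> p (a *: x) = a * p x).

Definition dominated (V : lmodType R) (p : V -> R) (f : {linear V -> R^o}) :=
  forall x, f x <= p x.

Definition seminorm (V : lmodType R) (p : V -> R) :=
  (forall x y, p (x + y) <= p x + p y) /\
  (forall a x, p (a *: x) = `|a| * p x).

Context {V : lmodType R}.
Implicit Types (p q N : V -> R) (f : {linear V -> R^o}).

Lemma seminorm_sublinear N : seminorm N -> sublinear N.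
Proof. by move=> [ND NZ]; split=> // a x a0; rewrite NZ ger0_norm. Qed.

Lemma sublinear0 p : sublinear p -> p 0 = 0.
Proof. by move=> [_ pZ]; rewrite -(scale0r (0 : V)) pZ// mul0r. Qed.

Lemma sublinearN_ge0 p x : sublinear p -> 0 <= p x + p (- x).
Proof. by move=> sp; rewrite -(sublinear0 sp) -(subrr x) (proj1 sp). Qed.

Lemma seminormN N x : seminorm N -> N (- x) = N x.
Proof. by move=> [_ NZ]; rewrite -scaleN1r NZ normrN1 mul1r. Qed.

Lemma seminorm_ge0 N x : seminorm N -> 0 <= N x.
Proof.
move=> sN; have := sublinearN_ge0 x (seminorm_sublinear sN).
by rewrite (seminormN _ sN); lra.
Qed.

Lemma linformZ f a x : f (a *: x) = a * f x.
Proof. exact: linearZ. Qed.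

Lemma dominated_norm N f x : seminorm N -> dominated N f -> `|f x| <= N x.
Proof.
move=> sN fN; rewrite ler_norml fN andbT lerNl.
by rewrite -(raddfN f) -(seminormN x sN) fN.
Qed.

Definition convex_cone (C : V -> R -> Prop) :=
  [/\ C 0 0,
      forall v w r s, C v r -> C w s -> C (v + w) (r + s) &
      forall a v r, 0 < a -> C v r -> C (a *: v) (a * r)].

(** The largest sublinear minorant [q] of [p] with [q (- v) <= r] for all
    [(v, r)] in the cone [C]: constraints are imposed on sublinear functionals
    by choosing such a cone of pairs. *)
Definition cone_inf p (C : V -> R -> Prop) (x : V) : R :=
  inf [set z | exists v r, C v r /\ z = p (x + v) + r].

Section cone_inf.
Variables (p : V -> R) (C : V -> R -> Prop).
Hypotheses (sp : sublinear p) (cC : convex_cone C).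
Hypothesis pC : forall v r, C v r -> 0 <= p v + r.

Let S x := [set z | exists v r, C v r /\ z = p (x + v) + r].

Let S0 x : S x !=set0.
Proof. by exists (p (x + 0) + 0); exists 0, 0; case: cC. Qed.

Let lbS x : has_lbound (S x).
Proof.
exists (- p (- x)) => _ [v [r [Cvr ->]]].
have := pC Cvr; have := proj1 sp (x + v) (- x); rewrite addrC addKr; lra.
Qed.

Lemma cone_inf_le x v r : C v r -> cone_inf p C x <= p (x + v) + r.
Proof. by move=> Cvr; apply: (ge_inf (lbS x)); exists v, r. Qed.

Lemma cone_inf_le_self x : cone_inf p C x <= p x.
Proof.
have [C0 _ _] := cC.
by apply: le_trans (cone_inf_le x C0) _; rewrite !addr0.
Qed.

Lemma cone_inf_sublinear : sublinear (cone_inf p C).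
Proof.
have [C0 CD CZ] := cC; split=> [x y|].
  apply: le_inf_add; [exact: S0|exact: S0|].
  move=> _ _ [v [r [Cv ->]]] [w [s [Cw ->]]].
  apply: le_trans (cone_inf_le _ (CD _ _ _ _ Cv Cw)) _.
  by rewrite addrACA; have := proj1 sp (x + v) (y + w); lra.
have le a x : 0 < a -> cone_inf p C (a *: x) <= a * cone_inf p C x.
  move=> a0; rewrite -ler_pdivrMl//.
  apply: lb_le_inf; [exact: S0|] => _ [v [r [Cv ->]]].
  rewrite ler_pdivrMl//; apply: le_trans (cone_inf_le _ (CZ _ _ _ a0 Cv)) _.
  by rewrite -scalerDr (proj2 sp a) ?(ltW a0)// mulrDr.
move=> a x; rewrite le_eqVlt => /orP[/eqP <-|a0].
  rewrite scale0r mul0r; apply/eqP; rewrite eq_le; apply/andP; split.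
    by rewrite -(sublinear0 sp) cone_inf_le_self.
  apply: lb_le_inf; [exact: S0|] => _ [v [r [Cv ->]]]; rewrite add0r; exact: pC.
apply/eqP; rewrite eq_le le//= -ler_pdivlMl//.
rewrite -{1}(scalerK (lt0r_neq0 a0) x); apply: le.
by rewrite invr_gt0.
Qed.

End cone_inf.

(** By Zorn's lemma: the infimum of a chain of sublinear functionals below [p]
    is sublinear, and finite because each of them is at least [- p (- x)] at
    [x]. *)
Lemma minimal_sublinear p : sublinear p -> exists q, [/\ sublinear q,
  forall x, q x <= p x &
  forall q', sublinear q' -> (forall x, q' x <= q x) -> q' = q].
Proof.
move=> sp; pose Q q := sublinear q /\ forall x, q x <= p x.
pose T := {q : V -> R | Q q}.
pose leT (q q' : T) : bool := `[< forall x, proj1_sig q' x <= proj1_sig q x >].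
have [||||[q [sq qp]] qmin] := @Zorn T leT.
- by move=> q; apply/asboolP.
- move=> r s t /asboolP rs /asboolP st; apply/asboolP => x.
  exact: le_trans (st x) (rs x).
- move=> [s Ps] [t Pt] /asboolP/= st /asboolP/= ts.
  apply: eq_exist => /=; apply/funext => x; apply/eqP.
  by rewrite eq_le ts st.
- move=> A totA; have [[q0 Aq0]|A0] := pselect (A !=set0); last first.
    by exists (exist Q p (conj sp (fun=> lexx _))) => s As; case: A0; exists s.
  pose S x := [set z | exists2 q : T, A q & z = proj1_sig q x].
  have S0 x : S x !=set0 by exists (proj1_sig q0 x); exists q0.
  have lbS x : has_lbound (S x).
    exists (- p (- x)) => _ [[q [sq qp]] _ ->] /=.
    by have := sublinearN_ge0 x sq; have := qp (- x); lra.
  have infS (q : T) x : A q -> inf (S x) <= proj1_sig q x.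
    by move=> Aq; apply: (ge_inf (lbS x)); exists q.
  have sS : sublinear (fun x => inf (S x)).
    split=> [x y|a x].
      apply: le_inf_add => // _ _ [q1 Aq1 ->] [q2 Aq2 ->].
      have [/asboolP l|/asboolP l] := totA _ _ Aq1 Aq2.
        apply: le_trans (infS _ _ Aq2) _.
        apply: le_trans (proj1 (proj1 (proj2_sig q2)) _ _) _.
        by rewrite lerD2r.
      apply: le_trans (infS _ _ Aq1) _.
      apply: le_trans (proj1 (proj1 (proj2_sig q1)) _ _) _.
      by rewrite lerD2l.
    have sZ (q : T) := proj2 (proj1 (proj2_sig q)).
    rewrite le_eqVlt => /orP[/eqP <-|a0].
      rewrite mul0r; apply/eqP; rewrite eq_le; apply/andP; split.
        by apply: le_trans (infS _ _ Aq0) _; rewrite sZ// mul0r.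
      by apply: lb_le_inf => // _ [q _ ->]; rewrite sZ// mul0r.
    apply/eqP; rewrite eq_le; apply/andP; split.
      rewrite -ler_pdivrMl//; apply: lb_le_inf => // _ [q Aq ->].
      by rewrite ler_pdivrMl// -sZ ?(ltW a0)// infS.
    apply: lb_le_inf => // _ [q Aq ->].
    by rewrite sZ ?(ltW a0)// ler_pM2l// infS.
  have Sp x : inf (S x) <= p x.
    by apply: le_trans (infS _ _ Aq0) _; exact: (proj2 (proj2_sig q0)).
  exists (exist Q _ (conj sS Sp)) => s As; apply/asboolP => x /=.
  exact: infS.
exists q; split=> // q' sq' q'q.
have q'p x : q' x <= p x by exact: le_trans (q'q x) (qp x).
by have /(_ _)/(congr1 (@proj1_sig _ _))/= := qmin (exist Q q' (conj sq' q'p));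
  apply; apply/asboolP.
Qed.

(** If [q (- x)] exceeded [- q x], forcing the value [- q x] at [- x] would
    give a strictly smaller sublinear functional; so a minimal one is odd,
    hence linear. *)
Lemma minimal_sublinearN q : sublinear q ->
  (forall q', sublinear q' -> (forall x, q' x <= q x) -> q' = q) ->
  forall x, q (- x) = - q x.
Proof.
move=> sq qmin x.
pose C v r := exists2 t : R, 0 <= t & v = t *: x /\ r = - (t * q x).
have cC : convex_cone C.
  split.
  - by exists 0 => //; rewrite scale0r mul0r oppr0.
  - move=> _ _ _ _ [t t0 [-> ->]] [u u0 [-> ->]]; exists (t + u).
      by rewrite addr_ge0.
    by rewrite scalerDl mulrDl opprD.
  - move=> a _ _ a0 [t t0 [-> ->]]; exists (a * t).
      by rewrite mulr_ge0// ltW.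
    by rewrite scalerA mulrN mulrA.
have qC v r : C v r -> 0 <= q v + r.
  by move=> [t t0 [-> ->]]; rewrite (proj2 sq)// subrr.
have /(_ _)/(congr1 (fun h => h (- x))) :=
  qmin _ (cone_inf_sublinear sq cC qC).
move=> /(_ (cone_inf_le_self sq cC qC)) qx.
have : cone_inf q C (- x) <= q (- x + x) - q x.
  by apply: cone_inf_le => //; exists 1; rewrite ?scale1r ?mul1r.
rewrite qx addNr (sublinear0 sq) => le1.
by have := sublinearN_ge0 x sq; lra.
Qed.

Lemma dominated_linear_form p : sublinear p ->
  exists f : {linear V -> R^o}, dominated p f.
Proof.
move=> /minimal_sublinear[q [sq qp /(minimal_sublinearN sq) qN]].
have qD x y : q (x + y) = q x + q y.
  apply/eqP; rewrite eq_le (proj1 sq)/=.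
  by have := proj1 sq (- x) (- y); rewrite -opprD !qN; lra.
have lq : linear (q : V -> R^o).
  move=> a x y; rewrite qD; congr (_ + _).
  have [a0|a0] := leP 0 a; first exact: (proj2 sq).
  by rewrite -[LHS]opprK -qN -scaleNr (proj2 sq) 1?oppr_ge0 ?ltW// mulNr opprK.
by exists (linear_of lq).
Qed.

End sublinear.

(** Stated along a linear map [T] instead of an inclusion, so that subspaces
    never have to be formed: [phi] is a form on the range of [T], pulled back
    to [V]. Any form below the largest sublinear minorant of [N] that is at
    most [phi x] at [T x] is an extension. *)
Theorem hahn_banach_along {R : realType} {V W : lmodType R}
    (T : {linear V -> W}) (N : W -> R) (phi : {linear V -> R^o}) :
  sublinear N -> (forall x, phi x <= N (T x)) ->
  exists f : {linear W -> R^o}, dominated N f /\ forall x, f (T x) = phi x.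
Proof.
move=> sN phiN; pose C v r := exists x, v = - T x /\ r = phi x.
have cC : convex_cone C.
  split.
  - by exists 0; rewrite !linear0 ?oppr0.
  - move=> _ _ _ _ [x [-> ->]] [y [-> ->]]; exists (x + y).
    by rewrite !linearD/=.
  - move=> a _ _ a0 [x [-> ->]]; exists (a *: x).
    by rewrite !linearZ/= scalerN.
have NC v r : C v r -> 0 <= N v + r.
  move=> [x [-> ->]]; have := phiN (- x); rewrite !linearN/=; lra.
have [f fle] := dominated_linear_form (cone_inf_sublinear sN cC NC).
have le x : f (T x) <= phi x.
  apply: le_trans (fle _) _.
  have CT : C (- T x) (phi x) by exists x.
  have := cone_inf_le sN NC (T x) CT.
  by rewrite subrr (sublinear0 sN) add0r.
exists f; split=> [w|x].
  by apply: le_trans (fle w) _; exact: cone_inf_le_self.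
apply/eqP; rewrite eq_le le/= -lerN2 -!raddfN; exact: le.
Qed.

Lemma norming_form {R : realType} {V : lmodType R} (N : V -> R) (x : V) :
  sublinear N -> exists2 f : {linear V -> R^o}, dominated N f & f x = N x.
Proof.
move=> sN.
have l1 : linear ((fun t => t *: x) : R^o -> V).
  by move=> a s t; rewrite scalerDl scalerA.
have l2 : linear ((fun t => t * N x) : R^o -> R^o).
  by move=> a s t; rewrite mulrDl -scalerAl.
have [t|f [fN fT]] := @hahn_banach_along R _ _ (linear_of l1) N (linear_of l2) sN.
  have [t0|/ltW t0] := leP 0 t; first by rewrite /= (proj2 sN).
  rewrite /= -[t in t *: x]opprK scaleNr -scalerN (proj2 sN) ?oppr_ge0//.
  by have := sublinearN_ge0 x sN; rewrite -oppr_ge0 in t0; nra.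
exists f => //; have /= := fT 1.
by rewrite scale1r mul1r.
Qed.

Lemma norm_seminorm {R : realType} (E : normedModType R) :
  seminorm (fun x : E => `|x|).
Proof. by split=> [x y|a x]; [exact: ler_normD|exact: normrZ]. Qed.

(** * The Banach space of bounded functions on a set *)

Section bounded_functions.
Context {R : realType} (I : Type).

Definition bounded_family : {pred I -> R} :=
  mem [set u : I -> R | exists M, forall i, `|u i| <= M].

Record bfun := BFun { bfun_fun :> I -> R; bfunP : bfun_fun \in bounded_family }.

HB.instance Definition _ := [isSub for bfun_fun].
HB.instance Definition _ := [Choice of bfun by <:].

Lemma bounded_family_submod : submod_closed bounded_family.
Proof.
split; first by rewrite inE; exists 0 => i; rewrite normr0.
move=> a f g; rewrite !inE => -[M fM] [K gK]; exists (`|a| * M + K) => i.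
by rewrite (le_trans (ler_normD _ _))// lerD// normrM ler_wpM2l.
Qed.

HB.instance Definition _ :=
  GRing.isSubmodClosed.Build _ _ bounded_family bounded_family_submod.
HB.instance Definition _ := [SubChoice_isSubLmodule of bfun by <:].

(** The value 0 is adjoined so that the supremum exists when [I] is empty. *)
Definition bfun_norm (u : bfun) : R :=
  sup [set r | r = 0 \/ exists i, r = `|u i|].

Lemma bfun_has_sup (u : bfun) : has_sup [set r | r = 0 \/ exists i, r = `|u i|].
Proof.
split; first by exists 0; left.
have /set_mem/= [M uM] := bfunP u; exists `|M| => _ [->//|[i ->]].
exact: le_trans (uM i) (ler_norm _).
Qed.

Lemma bfun_norm_ub (u : bfun) i : `|u i| <= bfun_norm u.
Proof. by apply: (sup_upper_bound (bfun_has_sup u)); right; exists i. Qed.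

Lemma bfun_norm_ge0 (u : bfun) : 0 <= bfun_norm u.
Proof. by apply: (sup_upper_bound (bfun_has_sup u)); left. Qed.

Lemma bfun_norm_le (u : bfun) e : 0 <= e -> (forall i, `|u i| <= e) ->
  bfun_norm u <= e.
Proof.
move=> e0 ue; apply: ge_sup; first by case: (bfun_has_sup u).
by move=> _ [->|[i ->]].
Qed.

Lemma bfun_normD u v : bfun_norm (u + v) <= bfun_norm u + bfun_norm v.
Proof.
apply: bfun_norm_le => [|i]; first by rewrite addr_ge0 ?bfun_norm_ge0.
by rewrite (le_trans (ler_normD _ _))// lerD ?bfun_norm_ub.
Qed.

Lemma bfun_normZ (a : R) u : bfun_norm (a *: u) = `|a| * bfun_norm u.
Proof.
have le b v : bfun_norm (b *: v) <= `|b| * bfun_norm v.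
  apply: bfun_norm_le => [|i]; first by rewrite mulr_ge0 ?bfun_norm_ge0.
  by rewrite normrM ler_wpM2l// bfun_norm_ub.
apply/eqP; rewrite eq_le le/=.
have [->|a0] := eqVneq a 0; first by rewrite normr0 mul0r bfun_norm_ge0.
rewrite -ler_pdivlMl ?normr_gt0// -[in leLHS](scalerK a0 u) -normfV.
exact: le.
Qed.

Lemma bfun_norm_eq0 u : bfun_norm u = 0 -> u = 0.
Proof.
move=> u0; apply/val_inj/funext => i /=; apply/eqP.
by rewrite -normr_le0 -u0 bfun_norm_ub.
Qed.

HB.instance Definition _ :=
  @Lmodule_isNormed.Build R bfun bfun_norm bfun_normD bfun_normZ bfun_norm_eq0.

Lemma bfun_complete (F : set_system bfun) : ProperFilter F -> cauchy F -> cvg F.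
Proof.
move=> FF Fc.
have Fe e : 0 < e -> exists w : bfun, \forall u \near F, `|w - u| <= e.
  move=> e0; have /cauchyP/(_ _ e0)[w Fw] := Fc.
  by exists w; apply: filterS Fw => u; rewrite -ball_normE/= => /ltW.
have Fn i : cvg ((fun u : bfun => u i) @ F).
  apply/cauchy_cvgP/cauchy_exP => e e0.
  have [|w Fw] := Fe (e / 2); first by rewrite divr_gt0.
  exists (w i); suff : \forall u \near F, ball (w i) e ((u : bfun) i) by [].
  apply: filterS Fw => u; rewrite -ball_normE/=.
  move=> /(le_trans (bfun_norm_ub (w - u) i))/= /le_lt_trans; apply.
  by rewrite ltr_pdivrMr// ltr_pMr// ltr1n.
pose x i := lim ((fun u : bfun => u i) @ F).
have xw (w : bfun) e : (\forall u \near F, `|w - u| <= e) ->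
    forall i, `|w i - x i| <= e.
  move=> Fw i.
  apply: (@closed_cvg _ _ F _ (fun u : bfun => `|w i - u i|) [set y | y <= e]).
  - exact: closed_le.
  - by apply: filterS Fw => u; apply: le_trans; exact: (bfun_norm_ub (w - u)).
  - by apply: cvg_norm; apply: cvgB; [exact: cvg_cst|exact: Fn].
have x0 : x \in bounded_family.
  rewrite inE /=; have [w Fw] := Fe 1 ltr01.
  exists (1 + bfun_norm w) => i.
  rewrite -(subrK (w i) (x i)) (le_trans (ler_normD _ _))// lerD ?bfun_norm_ub//.
  by rewrite distrC; exact: xw.
apply/cvg_ex; exists (BFun x0); apply/cvgrPdist_le => e e0.
have [|w Fw] := Fe (e / 2); first by rewrite divr_gt0.
near=> u.
rewrite -(subrK w (BFun x0)) -addrA (le_trans (ler_normD _ _))//.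
rewrite (splitr e) lerD//; last by near: u.
rewrite distrC; apply: bfun_norm_le => [|i]; first by rewrite divr_ge0// ltW.
exact: xw.
Unshelve. all: by end_near. Qed.

HB.instance Definition _ := Uniform_isComplete.Build bfun bfun_complete.

End bounded_functions.

(** * Types and the linear forms that they dominate *)

Section types.
Context {R : realType} (E : normedModType R) (n : nat).
Local Notation FE := (formal_extension E n).
Implicit Types (xi zeta : ntype E n) (x : FE) (b : E).

Definition base (b : E) : FE := (b, 0).

Lemma base_linear : linear base.
Proof.
by move=> a b c; rewrite /base; congr (_, _); rewrite /= ?scaler0 ?addr0.
Qed.

HB.instance Definition _ := GRing.isLinear.Build R E FE *:%R base base_linear.

Definition var (i : 'I_n) : FE := (0, delta_mx 0 i).

Lemma formal_extensionE x :
  x = base x.1 + \sum_(i < n) x.2 0 i *: var i.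
Proof.
have -> : \sum_(i < n) x.2 0 i *: var i = (0, x.2).
  rewrite [in RHS](row_sum_delta x.2).
  rewrite (big_morph (fun r : 'rV[R]_n => (0, r) : FE) (id1 := 0) (op1 := +%R))//.
    by apply: eq_bigr => i _; congr (_, _); rewrite /= scaler0.
  by move=> r s; congr (_, _); rewrite /= addr0.
by case: x => b r; congr (_, _); rewrite /= ?addr0 ?add0r.
Qed.

Lemma type_seminorm xi : seminorm xi.
Proof. by have /asboolP[xD xZ _] := type_normP xi; split. Qed.

Lemma type_base xi b : xi (base b) = `|b|.
Proof. by have /asboolP[_ _] := type_normP xi; exact. Qed.

(** The factor [r] keeps track of the norm of the form: a form of norm
    [r < 1] on [E] keeps the slack [1 - r] when it is extended. *)
Lemma type_extension xi (r : R) (f : {linear E -> R^o}) : 0 <= r ->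
  (forall b, f b <= r * `|b|) ->
  exists2 g : {linear FE -> R^o}, dominated (fun x => r * xi x) g &
    forall b, g (base b) = f b.
Proof.
move=> r0 fr; have [xiD xiZ] := type_seminorm xi.
have sN : sublinear (fun x => r * xi x).
  split=> [x y|a x a0]; first by rewrite -mulrDr ler_wpM2l.
  by rewrite xiZ ger0_norm// mulrCA.
have [b|g [gN gE]] := hahn_banach_along (phi := f) (T := base) sN.
  by rewrite type_base.
by exists g.
Qed.

Lemma type_extension1 xi (f : {linear E -> R^o}) :
  (forall b, f b <= `|b|) ->
  exists2 g : {linear FE -> R^o}, dominated xi g & forall b, g (base b) = f b.
Proof.
move=> f1; have [b|g gN gE] := @type_extension xi 1 f ler01.
  by rewrite mul1r.
by exists g => // x; rewrite -[leRHS]mul1r.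
Qed.

Section tuple_map.
Context (F : normedModType R) (j : isometric_embedding E F) (a : 'I_n -> F).

Definition tuple_map x : F := j x.1 + \sum_(i < n) x.2 0 i *: a i.

Lemma tuple_map_linear : linear tuple_map.
Proof.
move=> c x y; rewrite /tuple_map /= linearP/= scalerDr scaler_sumr addrACA.
congr (_ + _); rewrite -big_split/=; apply: eq_bigr => i _.
by rewrite !mxE scalerDl scalerA.
Qed.

HB.instance Definition _ :=
  GRing.isLinear.Build R FE F *:%R tuple_map tuple_map_linear.

Lemma tp_tuple_map x : tp j a x = `|tuple_map x|.
Proof. by []. Qed.

Lemma tuple_map_base b : tuple_map (base b) = j b.
Proof.
by rewrite /tuple_map/= big1 ?addr0// => i _; rewrite mxE scale0r.
Qed.

Lemma tuple_map_var i : tuple_map (var i) = a i.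
Proof.
rewrite /tuple_map/= linear0 add0r (bigD1 i)//= mxE !eqxx scale1r big1 ?addr0//.
by move=> k ki; rewrite mxE (negbTE ki) andbF scale0r.
Qed.

End tuple_map.

(** A form below [tp j a] is a form of norm at most 1 on the span of [E] and
    the [a i] inside [F]; an extension to [F] of norm at most 1 can be
    evaluated at the [b i]. *)
Lemma tp_form_transfer (F : normedModType R) (j : isometric_embedding E F)
    (a b : 'I_n -> F) (f : {linear FE -> R^o}) : dominated (tp j a) f ->
  exists g : {linear FE -> R^o}, [/\ dominated (tp j b) g,
    forall e, g (base e) = f (base e) &
    forall i, `|g (var i) - f (var i)| <= `|a i - b i|].
Proof.
move=> fa.
have [x|h [hN hT]] := hahn_banach_along (phi := f) (T := tuple_map j a)
  (seminorm_sublinear (norm_seminorm F)); first exact: fa.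
exists (h \o tuple_map j b : {linear FE -> R^o}); split => [x|e|i].
- exact: hN.
- by rewrite -hT /= !tuple_map_base.
- rewrite -hT /= !tuple_map_var -raddfB distrC.
  by apply: le_trans (dominated_norm _ (norm_seminorm F) hN) _.
Qed.

Section amalgam.
Variables xi zeta : ntype E n.

(** Two realisations amalgamate over [E] inside the bounded functions on the
    pairs of forms, one dominated by each type, that agree on [E]. *)
Definition amalgam_index := {p : {linear FE -> R^o} * {linear FE -> R^o} |
  [/\ dominated xi p.1, dominated zeta p.2 &
      forall b, p.1 (base b) = p.2 (base b)]}.

Lemma amalgam_bounded1 x :
  (fun p : amalgam_index => (proj1_sig p).1 x) \in @bounded_family R amalgam_index.
Proof.
rewrite inE; exists (xi x) => -[p [p1 p2 pE]] /=.
exact: dominated_norm (type_seminorm xi) p1.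
Qed.

Lemma amalgam_bounded2 x :
  (fun p : amalgam_index => (proj1_sig p).2 x) \in @bounded_family R amalgam_index.
Proof.
rewrite inE; exists (zeta x) => -[p [p1 p2 pE]] /=.
exact: dominated_norm (type_seminorm zeta) p2.
Qed.

Definition amalgam1 x : bfun amalgam_index := BFun (amalgam_bounded1 x).
Definition amalgam2 x : bfun amalgam_index := BFun (amalgam_bounded2 x).

Lemma amalgam1_linear : linear amalgam1.
Proof. by move=> a x y; apply/val_inj/funext => p; rewrite /= linearP. Qed.

Lemma amalgam2_linear : linear amalgam2.
Proof. by move=> a x y; apply/val_inj/funext => p; rewrite /= linearP. Qed.

HB.instance Definition _ :=
  GRing.isLinear.Build R FE (bfun amalgam_index) *:%R amalgam1 amalgam1_linear.
HB.instance Definition _ :=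
  GRing.isLinear.Build R FE (bfun amalgam_index) *:%R amalgam2 amalgam2_linear.

(** The form which norms [x] for [xi] occurs in such a pair because its
    restriction to [E] extends to a form dominated by [zeta]. *)
Lemma amalgam1_norm x : `|amalgam1 x| = xi x.
Proof.
apply/eqP; rewrite eq_le; apply/andP; split.
  apply: bfun_norm_le; first exact: seminorm_ge0 (type_seminorm xi).
  by move=> [p [p1 p2 pE]] /=; exact: dominated_norm (type_seminorm xi) p1.
have [f fxi <-] := norming_form x (seminorm_sublinear (type_seminorm xi)).
have [b|g gzeta gE] := @type_extension1 zeta (f \o base : {linear E -> R^o}).
  by rewrite -(type_base xi); exact: fxi.
have pP : [/\ dominated xi (f, g).1, dominated zeta (f, g).2 &
      forall b, (f, g).1 (base b) = (f, g).2 (base b)] by split=> // b; rewrite /= gE.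
apply: le_trans (ler_norm _) _.
exact: (bfun_norm_ub (amalgam1 x) (exist _ (f, g) pP)).
Qed.

Lemma amalgam2_norm x : `|amalgam2 x| = zeta x.
Proof.
apply/eqP; rewrite eq_le; apply/andP; split.
  apply: bfun_norm_le; first exact: seminorm_ge0 (type_seminorm zeta).
  by move=> [p [p1 p2 pE]] /=; exact: dominated_norm (type_seminorm zeta) p2.
have [f fzeta <-] := norming_form x (seminorm_sublinear (type_seminorm zeta)).
have [b|g gxi gE] := @type_extension1 xi (f \o base : {linear E -> R^o}).
  by rewrite -(type_base zeta); exact: fzeta.
have pP : [/\ dominated xi (g, f).1, dominated zeta (g, f).2 &
      forall b, (g, f).1 (base b) = (g, f).2 (base b)] by split=> // b; rewrite /= gE.
apply: le_trans (ler_norm _) _.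
exact: (bfun_norm_ub (amalgam2 x) (exist _ (g, f) pP)).
Qed.

Lemma amalgam_base b : amalgam1 (base b) = amalgam2 (base b).
Proof. by apply/val_inj/funext => -[p [_ _ pE]] /=. Qed.

Lemma amalgamation : exists (F : completeNormedModType R)
  (j : isometric_embedding E F) (a b : 'I_n -> F), tp j a = xi /\ tp j b = zeta.
Proof.
have jN e : `|(amalgam1 \o base : {linear E -> bfun amalgam_index}) e| = `|e|.
  by rewrite /= amalgam1_norm type_base.
exists (bfun amalgam_index), (IsometricEmbedding jN).
exists (amalgam1 \o var), (amalgam2 \o var); split.
  apply/val_inj/funext => x /=; rewrite -amalgam1_norm [in RHS](formal_extensionE x).
  rewrite linearD linear_sum; congr (`| _ + _ |).
  by apply: eq_bigr => i _; rewrite linearZ.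
apply/val_inj/funext => x /=; rewrite -amalgam2_norm [in RHS](formal_extensionE x).
rewrite linearD linear_sum; congr (`| _ + _ |); first exact: amalgam_base.
by apply: eq_bigr => i _; rewrite linearZ.
Qed.

End amalgam.

(** Amalgamation makes the set of distances nonempty, so a small infimum is
    approached by actual realisations. *)
Lemma type_dist_lt xi zeta e : type_dist xi zeta < e ->
  exists (F : completeNormedModType R) (j : isometric_embedding E F)
    (a b : 'I_n -> F),
  [/\ tp j a = xi, tp j b = zeta & forall i, `|a i - b i| < e].
Proof.
move=> de.
have [F [j [a [b [ja jb]]]]] := amalgamation xi zeta.
have [||_ [G [k [c [d [kc kd ->]]]]] lte] := @inf_adherent _
    [set r | exists (F : completeNormedModType R)
                      (j : isometric_embedding E F) (a b : 'I_n -> F),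
    [/\ tp j a = xi, tp j b = zeta &
        r = \big[Num.max/0]_(i < n) `|a i - b i|]] (e - type_dist xi zeta).
  by rewrite subr_gt0.
  split; first by exists (\big[Num.max/0]_(i < n) `|a i - b i|), F, j, a, b.
  by exists 0 => _ [G [k [c [d [_ _ ->]]]]]; exact: bigmax_ge_id.
exists G, k, c, d; split=> // i.
apply: le_lt_trans (le_bigmax 0 (fun i => `|c i - d i|) i) _.
by move: lte; rewrite -/(type_dist xi zeta) addrC subrK.
Qed.

Lemma type_dist_le (F : completeNormedModType R) (j : isometric_embedding E F)
    (a b : 'I_n -> F) (e : R) :
  0 <= e -> (forall i, `|a i - b i| <= e) -> type_dist (tp j a) (tp j b) <= e.
Proof.
move=> e0 abe; apply: (@le_trans _ _ (\big[Num.max/0]_(i < n) `|a i - b i|)).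
  apply: ge_inf; last by exists F, j, a, b.
  by exists 0 => _ [G [k [c [d [_ _ ->]]]]]; exact: bigmax_ge_id.
by apply: bigmax_le.
Qed.

End types.

(** * The topology on types, and realised types *)

Section pointwise_topology.
Context {R : realType} (S X : choiceType) (f : S -> {ptws X -> R}).
Local Notation W := (initial_topology f).

Definition pointwise_close (l : seq X) (d : R) (g h : X -> R) :=
  forall x, x \in l -> `|g x - h x| < d.

Lemma nbhs_initial_ptws (s : W) (U : set W) : nbhs s U <->
  exists (l : seq X) (d : R), 0 < d /\
    forall t : W, pointwise_close l d (f t) (f s) -> U t.
Proof.
split=> [[_ [[B oB <-] Bs] BU]|[l [d [d0 lU]]]]; last first.
  suff : \forall t \near s, pointwise_close l d (f t) (f s).
    by apply: filterS => t; exact: lU.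
  elim: l {lU} => [|x l IH]; first by near=> t.
  have cx : {for s, continuous (fun t : W => (f t : X -> R) x)}.
    apply: (@continuous_comp W {ptws X -> R} R f (proj x)).
      exact: initial_continuous.
    exact: proj_continuous.
  have fx : \forall t \near s, `|(f t : X -> R) x - (f s : X -> R) x| < d.
    have /cvgrPdist_lt/(_ d d0) := cx.
    by apply: filterS => t; rewrite distrC.
  apply: filterS2 fx IH => t tx tl y.
  by rewrite inE => /orP[/eqP->//|]; exact: tl.
pose F : set_system {ptws X -> R} := [set V | exists (l : seq X) (d : R), 0 < d /\
  forall g : X -> R, pointwise_close l d g (f s) -> V g].
have FF : Filter F.
  split.
  - by exists [::], 1; split.
  - move=> P Q [l [d [d0 lP]]] [m [e [e0 mQ]]]; exists (l ++ m), (Num.min d e).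
    split=> [|g gs]; first by rewrite lt_min d0.
    split; [apply: lP|apply: mQ] => x xl.
      have := gs x; rewrite mem_cat xl => /(_ isT).
      by rewrite lt_min => /andP[].
    have := gs x; rewrite mem_cat xl orbT => /(_ isT).
    by rewrite lt_min => /andP[].
  - by move=> P Q PQ [l [d [d0 lP]]]; exists l, d; split=> // g /lP/PQ.
have Fs : F --> f s.
  apply/cvg_sup => x V [_ [[C oC <-] Cx] CV].
  have : nbhs ((f s : X -> R) x) C by exact: open_nbhs_nbhs.
  move=> /nbhs_ballP[e /= e0 eC]; exists [:: x], e; split => // g gs.
  apply: CV; apply: eC; rewrite /ball/= distrC.
  by apply: gs; rewrite inE.
have [l [d [d0 lB]]] : F B by apply: Fs; exact: open_nbhs_nbhs.
by exists l, d; split=> // t ts; apply: BU; exact: lB.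
Unshelve. all: by end_near. Qed.

End pointwise_topology.

Lemma pointwise_closeW {R : realType} {X : choiceType} (l m : seq X) (d e : R)
    (g h : X -> R) : {subset l <= m} -> e <= d ->
  pointwise_close m e g h -> pointwise_close l d g h.
Proof. by move=> lm ed ge x /lm/ge/lt_le_trans; apply. Qed.

Section types.
Context {R : realType} (E : normedModType R) (n : nat).
Implicit Types (xi zeta : ntype E n).

Lemma nbhs_type xi U : nbhs xi U <-> exists (l : seq (formal_extension E n)) (d : R),
  0 < d /\ forall zeta, pointwise_close l d zeta xi -> U zeta.
Proof. exact: nbhs_initial_ptws. Qed.

Lemma nbhs_dual (f : dual E) U : nbhs f U <-> exists (l : seq E) (d : R),
  0 < d /\ forall g : dual E, pointwise_close l d g f -> U g.
Proof. exact: nbhs_initial_ptws. Qed.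

Lemma isolated_typeP xi : isolated_type xi <->
  forall e, 0 < e -> exists (l : seq (formal_extension E n)) (d : R),
  0 < d /\ forall zeta, pointwise_close l d zeta xi -> type_dist xi zeta < e.
Proof.
split=> [iso e e0|H U [e e0 eU]].
  by apply/(nbhs_type _ [set zeta | type_dist xi zeta < e])/iso; exists e.
apply/nbhs_type; have [l [d [d0 ld]]] := H e e0.
by exists l, d; split=> // zeta /ld; exact: eU.
Qed.

Lemma var_base_diff (F : normedModType R) (j : isometric_embedding E F)
    (b : 'I_n -> F) e i :
  tp j b (var E i - base n e) = `|b i - j e|.
Proof. by rewrite tp_tuple_map linearB/= tuple_map_var tuple_map_base. Qed.

Lemma type_base_zeros xi (a : 'I_n -> E) :
  (forall i, xi (var E i - base n (a i)) = 0) -> tp (iso_id E) a = xi.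
Proof.
move=> a0.
have [F [j [b [_ [jb _]]]]] := amalgamation xi xi.
rewrite -jb; apply/val_inj/funext => x /=.
have ba i : b i = j (a i).
  by apply/eqP; rewrite -subr_eq0 -normr_eq0 -var_base_diff jb a0.
rewrite /tp_fun; under [in RHS]eq_bigr => i _ do rewrite ba -linearZ.
by rewrite -[in RHS]linear_sum -[in RHS]linearD [in RHS]iso_norm.
Qed.

(** If [xi] is realised by [a], a type close to [xi] at the finitely many
    vectors [x_i - a_i] gives them small seminorm, and so all its realisations
    are close to [a]. *)
Lemma realised_isolated xi : realised_type xi -> isolated_type xi.
Proof.
move=> [a <-]; apply/isolated_typeP => e e0.
exists [seq var E i - base n (a i) | i : 'I_n], (e / 2).
split=> [|zeta close]; first by rewrite divr_gt0.
have [F [j [b [_ [jb _]]]]] := amalgamation zeta zeta.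
have tpa : tp j (j \o a) = tp (iso_id E) a.
  apply/esym/type_base_zeros => i.
  by rewrite var_base_diff subrr normr0.
rewrite -jb -tpa; apply: (@le_lt_trans _ _ (e / 2)); last first.
  by rewrite ltr_pdivrMr// ltr_pMr// ltr1n.
apply: type_dist_le => [|i]; first by rewrite divr_ge0// ltW.
rewrite distrC -var_base_diff jb.
have /close : var E i - base n (a i) \in [seq var E i - base n (a i) | i : 'I_n].
  exact: (fintype.image_f (fun i => var E i - base n (a i))).
by rewrite var_base_diff subrr normr0 subr0 => /(le_lt_trans (ler_norm _))/ltW.
Qed.

End types.

(** If every variable were at distance 0 from [E], approximations in [E] of a
    realisation would be Cauchy sequences, and completeness would place the
    realisation in [E]. *)
Lemma not_realised_dist {R : realType} (E : completeNormedModType R) (n : nat)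
    (xi : ntype E n) : ~ realised_type xi ->
  exists (i : 'I_n) (c : R), 0 < c /\ forall e, c <= xi (var E i - base n e).
Proof.
move=> nreal; apply: contrapT => H; apply: nreal.
have sxi := type_seminorm xi.
suff /choice[a aP] : forall i : 'I_n, exists e : E, xi (var E i - base n e) = 0.
  by exists a; exact: type_base_zeros.
move=> i.
have close k : exists e, xi (var E i - base n e) < k.+1%:R^-1.
  apply: contrapT => K; apply: H; exists i, k.+1%:R^-1; split=> // e.
  by rewrite leNgt; apply/negP => lt; apply: K; exists e.
have /choice[u uP] := close.
have [F [j [b [_ [jb _]]]]] := amalgamation xi xi.
have ub : (j \o u) @ \oo --> b i.
  apply/cvgrPdist_lt => e e0; near=> k.
  rewrite /= -var_base_diff jb; apply: lt_trans (uP k) _.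
  by near: k; exact: near_infty_natSinv_lt (PosNum e0).
have cu : cvg (u @ \oo).
  apply: cauchy_cvg; apply: cauchy_exP => e e0.
  have /cvgrPdist_lt/(_ (e / 2)) := ub.
  rewrite divr_gt0// => /(_ isT)[K _ Kb]; exists (u K); exists K => // k /= Kk.
  rewrite -ball_normE/= -(iso_norm j) linearB/=.
  rewrite -(subrKA (b i)) (le_lt_trans (ler_normD _ _))//.
  by rewrite (splitr e) ltrD//; [rewrite distrC; apply: (Kb K) => /=|exact: (Kb k)].
exists (lim (u @ \oo)); rewrite -jb var_base_diff.
suff -> : b i = j (lim (u @ \oo)) by rewrite subrr normr0.
apply: (cvg_unique _ ub); first exact: norm_hausdorff.
apply/cvgrPdist_lt => e e0; have /cvgrPdist_lt/(_ e e0) := cu.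
by apply: filterS => k; rewrite /= -linearB iso_norm.
Unshelve. all: by end_near. Qed.

(** * Extreme points of the dual ball *)

Section near_form.
Context {R : realType} (E : normedModType R).
Implicit Types (f g h : {linear E -> R^o}).

(** Neighbourhoods for pointwise convergence on all linear forms; on the dual
    ball they are those of the weak-star topology. *)
Definition near_form f (P : {linear E -> R^o} -> Prop) :=
  exists (l : seq E) (d : R), 0 < d /\
    forall g, pointwise_close l d (g : E -> R) (f : E -> R) -> P g.

Lemma near_formI f P Q : near_form f P -> near_form f Q ->
  near_form f (fun g => P g /\ Q g).
Proof.
move=> [l [d [d0 lP]]] [m [e [e0 mQ]]]; exists (l ++ m), (Num.min d e).
split=> [|g gf]; first by rewrite lt_min d0.
split; [apply: lP|apply: mQ]; apply: pointwise_closeW gf.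
- by move=> x xl; rewrite mem_cat xl.
- by rewrite ge_min lexx.
- by move=> x xl; rewrite mem_cat xl orbT.
- by rewrite ge_min lexx orbT.
Qed.

Lemma near_form_all (X : eqType) f (s : seq X) (P : X -> _ -> Prop) :
  (forall x, x \in s -> near_form f (P x)) ->
  near_form f (fun g => forall x, x \in s -> P x g).
Proof.
elim: s => [|x s IH] sP.
  by exists [::], 1; split.
have [|l [d [d0 lQ]]] := near_formI (sP x (mem_head x s)) (IH _).
  by move=> y ys; apply: sP; rewrite inE ys orbT.
exists l, d; split=> // g /lQ[Px sQ] y.
by rewrite inE => /orP[/eqP->//|]; exact: sQ.
Qed.

Lemma near_form_neq f g : ~ f =1 g -> near_form g (fun h => ~ f =1 h).
Proof.
move=> fg; have [x fgx] : exists x, f x != g x.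
  apply: contrapT => H; apply: fg => x; apply: contrapT => fgx.
  by apply: H; exists x; apply/eqP.
exists [:: x], `|f x - g x|; split; first by rewrite normr_gt0 subr_eq0.
by move=> h /(_ x (mem_head _ _)) + fh; rewrite fh ltxx.
Qed.

Lemma near_formS f P Q :
  (forall g, P g -> Q g) -> near_form f P -> near_form f Q.
Proof. by move=> PQ [l [d [d0 lP]]]; exists l, d; split=> // g /lP/PQ. Qed.

Lemma near_form_near f P :
  near_form f P -> near_form f (fun g => near_form g P).
Proof.
move=> [l [d [d0 lP]]]; exists l, (d / 2); split=> [|g gf]; first by rewrite divr_gt0.
exists l, (d / 2); split=> [|h hg]; first by rewrite divr_gt0.
apply: lP => x xl; rewrite -(subrKA (g x)) (splitr d).
by rewrite (le_lt_trans (ler_normD _ _))// ltrD ?hg ?gf.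
Qed.

(** For forms of norm at most 1 this is equivalent to being an extreme point
    of the dual ball, but speaks of vectors of [E] instead of forms: any two
    forms of the dual ball whose midpoint is [f] nearly attain the norm at [u]
    and at [u - x], hence take nearly equal values at [x]. *)
Definition quasi_extreme f := dominated (fun x => `|x|) f /\
  forall x t, 0 < t -> exists u,
    `|u| - f u < t /\ `|u - x| - f (u - x) < t.

Lemma quasi_extreme_neq f g (r : R) : (exists x : E, x != 0) -> r < 1 ->
  (forall x, `|g x| <= r * `|x|) -> quasi_extreme f -> ~ f =1 g.
Proof.
move=> [x x0] r1 gr [_ fx] fg.
have t0 : 0 < (1 - r) * `|x| / 2.
  by rewrite divr_gt0// mulr_gt0 ?subr_gt0// normr_gt0.
have [u []] := fx x _ t0; rewrite !fg.
have := ler_normB u (u - x); rewrite subKr.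
have := le_trans (ler_norm _) (gr u).
have := le_trans (ler_norm _) (gr (u - x)).
nra.
Qed.

Lemma quasi_extreme_surj f (s : R) : (exists x : E, x != 0) ->
  quasi_extreme f -> exists x, f x = s.
Proof.
move=> E0 qf; have [x fx] : exists x, f x != 0.
  apply: contrapT => H.
  apply: (@quasi_extreme_neq f (\0 : {linear E -> R^o}) 0) => //.
    by move=> y; rewrite normr0 mul0r.
  by move=> y; apply: contrapT => fy; apply: H; exists y; apply/eqP.
by exists ((s / f x) *: x); rewrite linformZ divfK.
Qed.

(** Slices of the dual ball form a neighbourhood basis at an extreme point.
    For a single [x], take approximate maximisers [u] and [u - x] of [f]: if
    [g] also nearly attains the norm at both, then [g x] is close to
    [|u| - |u - x|], hence to [f x]. For several [x], add up the vectors. *)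
Lemma quasi_extreme_slice f (l : seq E) (t : R) : quasi_extreme f -> 0 < t ->
  exists (w : E) (C : R), [/\ `|w| <= C, C - f w < t &
    forall g, dominated (fun x => `|x|) g -> forall x, x \in l ->
      `|g x - f x| <= (C - g w) + t].
Proof.
move=> qf; elim: l t => [|x l IH] t t0.
  by exists 0, 0; rewrite normr0 raddf0 subrr; split.
have [|w [C [wC Cw wP]]] := IH (t / 2); first by rewrite divr_gt0.
have [|u [u1 u2]] := proj2 qf x (t / 4); first by rewrite divr_gt0.
exists (w + u + (u - x)), (C + `|u| + `|u - x|); split.
- by rewrite (le_trans (ler_normD _ _))// lerD2r (le_trans (ler_normD _ _))// lerD2r.
- by rewrite !raddfD raddfN/= in u2 *; lra.
- move=> g g1 y; rewrite inE.
  have gw : g w <= C by exact: le_trans (g1 w) wC.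
  have gu := g1 u; have gux := g1 (u - x).
  have fu := proj1 qf u; have fux := proj1 qf (u - x).
  move=> /orP[/eqP->|yl].
    rewrite !raddfD !raddfN/= in u2 gux fux *.
    by rewrite ler_norml; apply/andP; split; lra.
  have := wP g g1 y yl.
  by rewrite !raddfD !raddfN/= in gux *; lra.
Qed.

End near_form.

Section dual.
Context {R : realType} (E : normedModType R).
Implicit Types (f g : dual E).

Lemma dual_linear f : linear (f : E -> R^o).
Proof. by have /set_mem[] := dual_funP f. Qed.

Definition dual_form f : {linear E -> R^o} := linear_of (dual_linear f).

Lemma dual_norm_has_sup f : has_sup [set `|f x| | x in [set x : E | `|x| <= 1]].
Proof.
split; first by exists `|f 0|, 0 => //=; rewrite normr0.
have cf : continuous (dual_form f) by have /set_mem[] := dual_funP f.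
have /bounded_funP/(_ 1)[M fM] := continuous_linear_bounded 0 (cf 0).
by exists M => _ [x x1 <-]; exact: fM.
Qed.

Lemma dual_norm_ub f x : `|f x| <= dual_norm f * `|x|.
Proof.
have [->|x0] := eqVneq x 0.
  by rewrite -[f 0]/(dual_form f 0) raddf0 !normr0 mulr0.
have nx0 : 0 < `|x| by rewrite normr_gt0.
have -> : `|f x| = `|dual_form f (`|x|^-1 *: x)| * `|x|.
  by rewrite linformZ normrM normfV normr_id mulrAC mulVf ?gt_eqF// mul1r.
rewrite ler_pM2r//; apply: (sup_upper_bound (dual_norm_has_sup f)).
by exists (`|x|^-1 *: x); rewrite //= normrZ normfV normr_id mulVf ?gt_eqF.
Qed.

Lemma dual_norm_le f (c : R) : 0 <= c -> (forall x, `|f x| <= c * `|x|) ->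
  dual_norm f <= c.
Proof.
move=> c0 fc; apply: ge_sup; first by case: (dual_norm_has_sup f).
by move=> _ [x /= x1 <-]; rewrite (le_trans (fc x))// ler_piMr.
Qed.

Lemma dual_ballP f : dual_ball f <-> dominated (fun x => `|x|) (dual_form f).
Proof.
split=> [f1 x|f1].
  rewrite (le_trans (ler_norm _))// (le_trans (dual_norm_ub f x))//.
  by rewrite ler_piMl.
apply: dual_norm_le => // x; rewrite mul1r.
exact: (dominated_norm _ (norm_seminorm E) f1).
Qed.

Lemma dual_of_form (c : R) (f : {linear E -> R^o}) :
  (forall x, `|f x| <= c * `|x|) -> exists g : dual E, dual_form g =1 f.
Proof.
move=> fc.
have fP : (f : E -> R) \in @continuous_linear_form R E.
  rewrite inE; split; first exact: linearP.
  apply/linear_bounded_continuous/bounded_funP => r.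
  exists (`|c| * r) => x xr; rewrite (le_trans (fc x))//.
  rewrite (le_trans (ler_norm _))// normrM normr_id ler_wpM2l//.
by exists (Dual fP).
Qed.

(** The infimum [q x] of the defects [|u| - f u + |u - x| - f (u - x)] over
    all [u] is sublinear in [x]. A form [h <= q] satisfies [h <= |.| - f] and
    [h <= |.| + f], so [f + h] and [f - h] both lie in the dual ball, and [f]
    is their midpoint: extremality forces [h = 0], whence [q <= 0]. *)
Lemma extreme_quasi_extreme f : extreme_points (@dual_ball R E) f ->
  quasi_extreme (dual_form f).
Proof.
move=> [fball fext]; split; first exact/dual_ballP.
have [phi phiE] : exists phi : {linear E -> R^o}, phi =1 f.
  by exists (dual_form f).
have phi1 : dominated (fun x => `|x|) phi.
  by move=> x; rewrite phiE; exact: (proj1 (dual_ballP f) fball).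
pose p x := `|x| + phi x; pose C v r := p v <= r.
have p0 v : 0 <= p v by have := phi1 (- v); rewrite normrN raddfN/= /p; lra.
have sp : sublinear p.
  split=> [x y|a x a0]; last first.
    by rewrite /p normrZ ger0_norm// linformZ mulrDr.
  by rewrite /p raddfD/=; have := ler_normD x y; lra.
have cC : convex_cone C.
  split; rewrite /C; first by rewrite (sublinear0 sp).
  - by move=> v w r s vr ws; have := proj1 sp v w; lra.
  - by move=> a v r a0 vr; rewrite (proj2 sp) ?(ltW a0)// ler_pM2l.
have pC v r : C v r -> 0 <= p v + r by rewrite /C; have := p0 v; lra.
have qle x : cone_inf p C x <= 0.
  have [h hq <-] := norming_form x (cone_inf_sublinear sp cC pC).
  have h1 y : h y <= `|y| + phi y.
    by apply: le_trans (hq y) _; exact: cone_inf_le_self.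
  have h2 y : h y <= `|y| - phi y.
    have CN : C (- y) (`|y| - phi y) by rewrite /C /p normrN raddfN.
    apply: le_trans (hq y) _; apply: le_trans (cone_inf_le sp pC y CN) _.
    by rewrite subrr (sublinear0 sp) add0r.
  have b1 : dominated (fun x => `|x|) (phi \+ h : {linear E -> R^o}).
    by move=> y /=; have := h2 y; lra.
  have b2 : dominated (fun x => `|x|) (phi \- h : {linear E -> R^o}).
    by move=> y /=; have := h1 (- y); rewrite normrN !raddfN/=; lra.
  have [y|g1 g1E] := @dual_of_form 1 (phi \+ h : {linear E -> R^o}).
    by rewrite mul1r; exact: dominated_norm (norm_seminorm E) b1.
  have [y|g2 g2E] := @dual_of_form 1 (phi \- h : {linear E -> R^o}).
    by rewrite mul1r; exact: dominated_norm (norm_seminorm E) b2.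
  have B1 : dual_ball g1 by apply/dual_ballP => y; rewrite g1E; exact: b1.
  have B2 : dual_ball g2 by apply/dual_ballP => y; rewrite g2E; exact: b2.
  have half : 0 < (1 / 2 : R) < 1 by apply/andP; split; lra.
  have fE : f = (1 / 2) *: g1 + (1 - 1 / 2) *: g2.
    apply/val_inj/funext => y /=.
    rewrite -phiE -[RHS]/(1 / 2 * g1 y + (1 - 1 / 2) * g2 y).
    have := g1E y; have := g2E y => /= -> ->; lra.
  have [g1f _] := fext _ _ _ B1 B2 half fE.
  by have := g1E x; rewrite g1f /= -phiE; lra.
move=> x t t0.
have [_ [v [r [Cvr ->]]] lt] : exists2 z,
    [set z | exists v r, C v r /\ z = p (x + v) + r] z & z < t.
  apply: inf_lt; last exact: le_lt_trans (qle x) t0.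
  by exists (p (x + 0) + 0); exists 0, 0; case: cC.
exists (- v); rewrite !(raddfN, raddfB)/= -!phiE -opprD !normrN opprK.
have := p0 v; have := p0 (x + v); move: Cvr lt.
by rewrite /C /p raddfD/= [v + x]addrC; split; lra.
Qed.

End dual.

(** * Perturbing a type through the forms that it dominates *)

Section perturbation.
Context {R : realType} (E : normedModType R) (n : nat).
Local Notation FE := (formal_extension E n).
Local Notation form := {linear FE -> R^o}.
Implicit Types (xi zeta : ntype E n) (f g : form).

(** New types are made from old ones by adding or removing forms, which leaves
    only the norm on [E] to be checked. *)
Lemma type_of_forms (A : form -> Prop) :
  (forall x, exists M, forall f, A f -> `|f x| <= M) ->
  (forall f, A f -> forall e, f (base n e) <= `|e|) ->
  (forall e, exists2 f, A f & f (base n e) = `|e|) ->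
  exists zeta, (forall f, A f -> forall x, `|f x| <= zeta x) /\
    (forall x c, (forall f, A f -> `|f x| <= c) -> zeta x <= c).
Proof.
move=> Abnd Abase Anorm; pose S x := [set r | exists2 f, A f & r = `|f x|].
have hsS x : has_sup (S x).
  split; first by have [f Af _] := Anorm 0; exists `|f x|; exists f.
  by have [M AM] := Abnd x; exists M => _ [f Af ->]; exact: AM.
have ubS f x : A f -> `|f x| <= sup (S x).
  by move=> Af; apply: (sup_upper_bound (hsS x)); exists f.
have leS x c : (forall f, A f -> `|f x| <= c) -> sup (S x) <= c.
  move=> fc; apply: ge_sup; first exact: (proj1 (hsS x)).
  by move=> _ [f Af ->]; exact: fc.
have S_semi : seminorm_extending (fun x => sup (S x)).
  split=> [x y|a x|e].
  - apply: leS => f Af; rewrite raddfD (le_trans (ler_normD _ _))//.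
    by rewrite lerD ?ubS.
  - have le b y : sup (S (b *: y)) <= `|b| * sup (S y).
      by apply: leS => f Af; rewrite linformZ normrM ler_wpM2l ?ubS.
    apply/eqP; rewrite eq_le le/=.
    have [->|a0] := eqVneq a 0.
      have [f Af _] := Anorm 0.
      by rewrite normr0 mul0r (le_trans _ (ubS f _ Af)).
    rewrite -ler_pdivlMl ?normr_gt0// -[in leLHS](scalerK a0 x) -normfV.
    exact: le.
  - apply/eqP; rewrite eq_le; apply/andP; split.
      apply: leS => f Af; rewrite ler_norml (Abase f Af) andbT.
      by have := Abase f Af (- e); rewrite !raddfN normrN lerNl.
    have [f Af fe] := Anorm e.
    by rewrite -fe (le_trans (ler_norm _))// (ubS f).
exists (NType (asboolT S_semi)); split=> [f Af x|x c] /=; first exact: ubS.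
exact: leS.
Qed.

Lemma norming_type_form xi x : exists2 f, dominated xi f & f x = xi x.
Proof. exact: norming_form (seminorm_sublinear (type_seminorm xi)). Qed.

Lemma dominated_type_norm xi f x : dominated xi f -> `|f x| <= xi x.
Proof. exact: dominated_norm (type_seminorm xi). Qed.

Lemma dominated_type_base xi f : dominated xi f ->
  dominated (fun e : E => `|e|) (f \o base n : {linear E -> R^o}).
Proof. by move=> fxi e; rewrite -(type_base xi); exact: fxi. Qed.

Lemma type_dist_transfer xi zeta (d : R) (i : 'I_n) f :
  type_dist xi zeta < d -> dominated xi f ->
  exists g, [/\ dominated zeta g, forall e, g (base n e) = f (base n e) &
    `|g (var E i) - f (var E i)| < d].
Proof.
move=> /type_dist_lt[F [j [a [b [ja jb abd]]]]] fxi.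
rewrite -ja in fxi; have [g [gb gE gv]] := tp_form_transfer b fxi.
exists g; split=> //; first by rewrite -jb.
exact: le_lt_trans (gv i) (abd i).
Qed.

Lemma type_dist_transfer_sym xi zeta (d : R) (i : 'I_n) f :
  type_dist xi zeta < d -> dominated zeta f ->
  exists g, [/\ dominated xi g, forall e, g (base n e) = f (base n e) &
    `|g (var E i) - f (var E i)| < d].
Proof.
move=> /type_dist_lt[F [j [a [b [ja jb abd]]]]] fxi.
rewrite -jb in fxi; have [g [gb gE gv]] := tp_form_transfer a fxi.
exists g; split=> //; first by rewrite -ja.
by apply: le_lt_trans (gv i) _; rewrite distrC.
Qed.

(** Fibres over [E] of the forms dominated by an isolated type vary
    semicontinuously. Shifting [f] to restrict to [mu] on [E] and adding the
    shifted form to those dominated by [xi] moves the seminorm very little at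
    the vectors of [l]; the resulting type is then close to [xi], so the
    shifted form has a neighbour dominated by [xi]. *)
Lemma isolated_extension_near xi (i : 'I_n) (l : seq FE) (d e : R) f
    (mu : {linear E -> R^o}) : 0 < d ->
  (forall zeta, pointwise_close l d zeta xi -> type_dist xi zeta < e) ->
  dominated xi f -> dominated (fun b => `|b|) mu ->
  (forall x, x \in l -> `|mu x.1 - f (base n x.1)| < d) ->
  exists g, [/\ dominated xi g, forall b, g (base n b) = mu b &
    `|g (var E i) - f (var E i)| < e].
Proof.
move=> d0 isoxi fxi mu1 muf.
have l' : linear ((fun x => f x + (mu x.1 - f (base n x.1))) : FE -> R^o).
  move=> a x y; have -> : (a *: x + y).1 = a *: x.1 + y.1 by [].
  by rewrite !linearP /GRing.scale/=; ring.
pose f' : form := linear_of l'.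
have f'E x : f' x = f x + (mu x.1 - f (base n x.1)) by [].
have f'base b : f' (base n b) = mu b by rewrite f'E /=; ring.
have f'var k : f' (var E k) = f (var E k).
  by rewrite f'E /= !raddf0 !addr0.
have [x|g [gxi|->] b|b|zeta [zetaA zeta_le]] :=
    @type_of_forms (fun g => dominated xi g \/ g = f').
- exists (xi x + `|f' x|) => g [gxi|->]; last first.
    by rewrite lerDr seminorm_ge0//; exact: type_seminorm.
  by rewrite (le_trans (dominated_type_norm x gxi))// lerDl.
- exact: (dominated_type_base gxi).
- by rewrite f'base.
- have [g gxi gb] := norming_type_form xi (base n b).
  by exists g; [left|rewrite gb type_base].
have close : pointwise_close l d zeta xi.
  move=> x xl; apply: le_lt_trans (muf x xl).
  have zx : xi x <= zeta x.
    have [g gxi <-] := norming_type_form xi x.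
    by apply: le_trans (ler_norm _) _; apply: zetaA; left.
  rewrite ger0_norm ?subr_ge0// lerBlDl; apply: zeta_le => g [gxi|->].
    by rewrite (le_trans (dominated_type_norm x gxi))// lerDl.
  by rewrite f'E (le_trans (ler_normD _ _))// lerD2r dominated_type_norm.
have f'zeta : dominated zeta f'.
  by move=> x; rewrite (le_trans (ler_norm _))// zetaA//; right.
have [g [gxi gb gv]] := type_dist_transfer_sym i (isoxi _ close) f'zeta.
by exists g; split; rewrite -?f'var => // b; rewrite gb.
Qed.

(** A form that norms the variable for the distance to [E] vanishes on [E]. *)
Lemma distance_form xi (i : 'I_n) (c : R) :
  (forall e, c <= xi (var E i - base n e)) ->
  exists f, [/\ dominated xi f, forall e, f (base n e) = 0 & c <= f (var E i)].
Proof.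
move=> cxi; pose C (v : FE) (r : R) := exists e, v = base n e /\ r = 0.
have cC : convex_cone C.
  split; first by exists 0; rewrite linear0.
  - move=> _ _ _ _ [e [-> ->]] [e' [-> ->]]; exists (e + e').
    by rewrite linearD addr0.
  - by move=> a _ _ a0 [e [-> ->]]; exists (a *: e); rewrite linearZ mulr0.
have sxi := seminorm_sublinear (type_seminorm xi).
have xiC v r : C v r -> 0 <= xi v + r.
  by move=> [e [-> ->]]; rewrite addr0 type_base.
have [f fq fv] := norming_form (var E i) (cone_inf_sublinear sxi cC xiC).
have f0 e : f (base n e) <= 0.
  apply: le_trans (fq _) _.
  have Ce : C (- base n e) 0 by exists (- e); rewrite linearN.
  apply: le_trans (cone_inf_le sxi xiC _ Ce) _.
  by rewrite subrr addr0 (sublinear0 sxi).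
exists f; split=> [x|e|].
- by apply: le_trans (fq x) _; exact: cone_inf_le_self.
- by apply/eqP; rewrite eq_le f0/=; have := f0 (- e); rewrite !raddfN oppr_le0.

- rewrite fv; apply: lb_le_inf.
    by exists (xi (var E i + 0) + 0); exists 0, 0; case: cC.
  move=> _ [_ [_ [[e [-> ->]] ->]]]; rewrite addr0.
  by have := cxi (- e); rewrite raddfN opprK.
Qed.

End perturbation.

(** The fibre of [xi] over an extreme point [mu] is cut down to values near
    [s], without changing the seminorm at the vectors of [l]. Over a small
    slice of the dual ball around [mu] only the forms with value about [s] at
    the variable are kept, symmetrically over the opposite slice, and
    elsewhere all of them. The result is still a type, since forms remain over
    the whole dual ball, and the norming forms [f x] remain because they lie
    outside both slices. That the fibre over [mu] really becomes small,
    although weak-star limits of convex combinations come back, is where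
    extremality enters, through the slice. *)
Lemma concentrated_type {R : realType} (E : normedModType R) (n : nat)
    (xi : ntype E n) (i : 'I_n) (s e : R) (mu : {linear E -> R^o})
    (l : seq (formal_extension E n))
    (f : formal_extension E n -> {linear formal_extension E n -> R^o}) :
  0 < e -> quasi_extreme mu -> (exists h, mu h = s) ->
  near_form mu (fun nu => dominated (fun b => `|b|) nu -> exists g,
    [/\ dominated xi g, forall b, g (base n b) = nu b &
        `|g (var E i) - s| <= e]) ->
  (forall x, x \in l -> dominated xi (f x) /\ f x x = xi x) ->
  near_form mu (fun nu => forall x, x \in l ->
    ~ f x \o base n =1 nu /\ ~ (\- (f x \o base n)) =1 nu) ->
  exists zeta : ntype E n, (forall x, x \in l -> zeta x = xi x) /\
    forall g, dominated zeta g -> (forall b, g (base n b) = mu b) ->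
      `|g (var E i) - s| <= 3 * e.
Proof.
move=> e0 qmu [h muh] ext fxi avoid; have sxi := type_seminorm xi.
have [lm [d [d0 near_mu]]] := near_formI ext avoid.
pose eta := Num.min d e.
have eta0 : 0 < eta by rewrite lt_min d0.
(* As [mu h = s], the value at [z] measures the deviation from [s] over forms
   near [mu], and it does so linearly. *)
pose y := var E i; pose z := y - base n h.
pose M := xi z + 1; have M0 : 0 < M by have := seminorm_ge0 z sxi; rewrite /M; lra.
(* [bt] is the depth of the slice. The point [mu] lies above its base by all
   but [tau] of that depth, and [T] weighs the slice direction [w] against
   [z] in the test vector below. *)
have [bt bt0 etabt] : exists2 bt, 0 < bt & eta = 2 * bt.
  by exists (eta / 2); [rewrite divr_gt0|field].
have [T T0 Tbt] : exists2 T, 0 < T & T * bt = 2 * M.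
  by exists (2 * M / bt); rewrite ?divfK ?gt_eqF// divr_gt0// mulr_gt0.
have [tau [tau0 taubt Ttau]] : exists tau, [/\ 0 < tau, tau <= bt / 2 & T * tau <= e].
  exists (Num.min (bt / 2) (e / T)); split.
  - by rewrite lt_min !divr_gt0.
  - by rewrite ge_min lexx.
  - by rewrite mulrC -ler_pdivlMr// ge_min lexx orbT.
have [w [C [wC Cw slice]]] := quasi_extreme_slice (h :: lm) qmu tau0.
have near_slice nu : dominated (fun b => `|b|) nu -> C - bt < nu w ->
    forall x, x \in h :: lm -> `|nu x - mu x| < eta.
  move=> nu1 nuw x xl; apply: le_lt_trans (slice nu nu1 x xl) _.
  by lra.
pose A (g : {linear formal_extension E n -> R^o}) := dominated xi g /\
  (`|g (base n w)| <= C - bt \/ `|g z| <= 2 * e).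
have in_slice nu : dominated (fun b => `|b|) nu -> C - bt < nu w ->
    pointwise_close lm d nu mu.
  move=> nu1 nuw x xl; apply: lt_le_trans (near_slice nu nu1 nuw x _) _.
    by rewrite inE xl orbT.
  by rewrite ge_min lexx.
have inA_slice nu : dominated (fun b => `|b|) nu -> C - bt < nu w ->
    exists2 g, A g & forall b, g (base n b) = nu b.
  move=> nu1 nuw; have [/(_ nu1)[g [gxi gE gs]] _] := near_mu _ (in_slice nu nu1 nuw).
  exists g => //; split=> //; right.
  have := near_slice nu nu1 nuw h (mem_head _ _).
  have etae : eta <= e by rewrite ge_min lexx orbT.
  rewrite muh raddfB/= gE -/y in gs * => nuh.
  have -> : g y - nu h = (g y - s) - (nu h - s) by ring.
  by rewrite (le_trans (ler_normB _ _))//; lra.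
have inA nu : dominated (fun b => `|b|) nu -> exists2 g, A g &
    forall b, g (base n b) = nu b.
  move=> nu1; have [nuw|nuw] := leP `|nu w| (C - bt).
    have [b|g gxi gE] := @type_extension1 _ _ n xi nu; first exact: nu1.
    by exists g => //; split=> //; left; rewrite gE.
  have [w0|w0] := leP 0 (nu w).
    by apply: inA_slice => //; rewrite ger0_norm in nuw.
  have nuN1 : dominated (fun b => `|b|) (\- nu : {linear E -> R^o}).
    by move=> b /=; rewrite -raddfN -normrN; exact: nu1.
  have [|g [gxi gw] gE] := inA_slice _ nuN1; first by rewrite ltr0_norm in nuw.
  exists (\- g) => [|b]; last by rewrite /= gE/= opprK.
  split=> [x|] /=; last by rewrite !normrN.
  by rewrite -raddfN -(seminormN _ sxi); exact: gxi.
have [x|g [gxi _] b|b|zeta [zetaA zeta_le]] := @type_of_forms _ E n A.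
- by exists (xi x) => g [gxi _]; exact: dominated_type_norm.
- exact: (dominated_type_base gxi).
- have [nu nu1 nub] := norming_form b (seminorm_sublinear (norm_seminorm E)).
  by have [g Ag gnu] := inA nu nu1; exists g; rewrite ?gnu.
exists zeta; split=> [x xl|g gzeta gmu].
  have [fx fxx] := fxi x xl.
  have f1 := dominated_type_base fx.
  apply/eqP; rewrite eq_le; apply/andP; split.
    by apply: zeta_le => g [gxi _]; exact: dominated_type_norm.
  rewrite -fxx; apply: le_trans (ler_norm _) _; apply: zetaA; split=> //; left.
  rewrite leNgt; apply/negP; have [w0|w0] := leP 0 (f x (base n w)).
    rewrite ger0_norm// => fw; have [_ /(_ x xl)[]] := near_mu _ (in_slice _ f1 fw).
    by [].
  rewrite ltr0_norm// => fw.
  have fN1 : dominated (fun b => `|b|) (\- (f x \o base n) : {linear E -> R^o}).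
    by move=> b /=; rewrite -!raddfN -normrN; exact: f1.
  by have [_ /(_ x xl)[]] := near_mu _ (in_slice _ fN1 fw).
(* On [T w + z] the forms outside the slice lose [T * bt], which outweighs
   their value at [z]; those inside are at most [2 e] at [z]. A form that
   restricts to [mu] gains nearly [T * C] on [T w], so little room is left at
   [z]. *)
have gz sg : `|sg| = 1 -> sg * g z <= 3 * e.
  move=> sg1; pose v := T *: base n w + sg *: z.
  have : zeta v <= Num.max (T * (C - bt) + xi z) (T * C + 2 * e).
    apply: zeta_le => k [kxi kw].
    have kv : `|k v| <= T * `|k (base n w)| + `|k z|.
      have -> : k v = T * k (base n w) + sg * k z by rewrite /v linearD !linformZ.
      apply: le_trans (ler_normD _ _) _.
      by rewrite !normrM sg1 mul1r gtr0_norm.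
    apply: le_trans kv _; rewrite le_max; apply/orP; case: kw => kw; [left|right].
      by rewrite lerD ?ler_pM2l// dominated_type_norm.
    rewrite lerD// ler_pM2l// (le_trans _ wC)// -(type_base xi).
    exact: dominated_type_norm.
  move=> /(le_trans (gzeta v)); rewrite /v linearD !linformZ gmu.
  have Tmu : T * (C - tau) <= T * mu w by rewrite ler_pM2l//; lra.
  by rewrite le_max => /orP[] gv; rewrite /M in Tbt M0; lra.
have -> : g (var E i) - s = g z by rewrite raddfB/= gmu muh.
rewrite ler_norml lerNl; apply/andP; split.
  by rewrite -mulN1r; apply: gz; rewrite normrN1.
by rewrite -[g z]mul1r; apply: gz; rewrite normr1.
Qed.

(** * Isolated types are realised *)

Section isolated_realised.
Context {R : realType} (E : completeNormedModType R).
Hypothesis E_neq0 : exists x : E, x != 0.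
Variables (lambda : {linear E -> R^o}) (r : R).
Hypotheses (r0 : 0 <= r) (r1 : r < 1).
Hypothesis lambda_le : forall x, `|lambda x| <= r * `|x|.
Hypothesis quasi_extreme_adherent : forall P : {linear E -> R^o} -> Prop,
  near_form lambda P -> exists2 mu, quasi_extreme mu & P mu.

(** Only [f = lambda] is not separated from [lambda] by a neighbourhood, and
    an extreme point has norm 1, unlike [lambda]. *)
Lemma near_quasi_extreme_neq (f : {linear E -> R^o}) :
  near_form lambda (fun mu => quasi_extreme mu -> ~ f =1 mu).
Proof.
have [fl|fl] := pselect (f =1 lambda); last first.
  by apply: near_formS (near_form_neq fl) => mu + _.
exists [::], 1; split=> // mu _ qmu fmu.
by apply: (quasi_extreme_neq E_neq0 r1 lambda_le qmu) => x; rewrite -fmu fl.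
Qed.

(** If [xi] is not realised, the slack [1 - r] leaves room for two extensions
    [phi_ 1] and [phi_ (- 1)] of [lambda] that differ at a variable. By
    isolation, the fibre of [xi] over a nearby extreme point [mu] still
    contains forms near both. Concentrating that fibre near one of them gives
    a type equal to [xi] at the test vectors but metrically far from it. *)
Theorem isolated_realised (n : nat) (xi : ntype E n) :
  isolated_type xi -> realised_type xi.
Proof.
move=> iso; apply: contrapT => nreal.
have [i [c [c0 cxi]]] := not_realised_dist nreal.
have [nu [nuxi nu0 cnu]] := distance_form cxi.
have [b|phi phixi phiE] := @type_extension _ _ n xi r lambda r0.
  exact: le_trans (ler_norm _) (lambda_le b).
pose D := (1 - r) * nu (var E i).
have D0 : 0 < D by rewrite mulr_gt0 ?subr_gt0// (lt_le_trans c0).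
pose phi_ (s : R) : {linear formal_extension E n -> R^o} :=
  phi \+ (s * (1 - r) \*: nu).
have phi_xi s : `|s| = 1 -> dominated xi (phi_ s).
  move=> s1 x; have r1' : 0 <= 1 - r by rewrite subr_ge0 ltW.
  have := ler_wpM2l r1' (dominated_type_norm x nuxi).
  have := ler_norm (s * (1 - r) * nu x).
  rewrite !normrM s1 mul1r ger0_norm//.
  by have := phixi x; rewrite /phi_ /= /GRing.scale/=; lra.
have phi_E s b : phi_ s (base n b) = lambda b.
  by rewrite /phi_ /= nu0 phiE scaler0 addr0.
have phi_v s : phi_ s (var E i) = phi (var E i) + s * D.
  by rewrite /phi_ /= /GRing.scale/= mulrA.
(* The two values at the variable are [2 * D] apart, while the final estimate
   accumulates errors of [3 * (D / 4)], [D / 4] and [D / 4]. *)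
have e0 : 0 < D / 4 by rewrite divr_gt0.
have /isolated_typeP/(_ _ e0)[l [d [d0 isoxi]]] := iso.
have /choice[f fP] : forall x, exists f : {linear formal_extension E n -> R^o},
    dominated xi f /\ f x = xi x.
  by move=> x; have [f] := norming_type_form xi x; exists f.
have ext s : `|s| = 1 -> near_form lambda (fun mu =>
    dominated (fun b => `|b|) mu -> exists g, [/\ dominated xi g,
    forall b, g (base n b) = mu b &
    `|g (var E i) - (phi (var E i) + s * D)| <= D / 4]).
  move=> s1; exists [seq x.1 | x : formal_extension E n <- l], d; split=> // mu mul mu1.
  have [x xl|g [gxi gE gv]] := isolated_extension_near i d0 isoxi (phi_xi s s1) mu1.
    by rewrite phi_E; apply: mul; apply/mapP; exists x.
  by exists g; split=> //; rewrite -phi_v ltW.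
have avoid : near_form lambda (fun mu => forall x, x \in l ->
    (quasi_extreme mu -> ~ f x \o base n =1 mu) /\
    (quasi_extreme mu -> ~ (\- (f x \o base n)) =1 mu)).
  by apply: near_form_all => x _; apply: near_formI;
    exact: near_quasi_extreme_neq.
have [mu qmu [[mu_p mu_m] mu_avoid]] := quasi_extreme_adherent
  (near_formI (near_formI (near_form_near (ext 1 (normr1 _)))
     (near_form_near (ext (-1) (normrN1 _)))) avoid).
have [zeta [zetaE zetaP]] : exists zeta : ntype E n, (forall x, x \in l -> zeta x = xi x) /\
    forall g, dominated zeta g -> (forall b, g (base n b) = mu b) ->
      `|g (var E i) - (phi (var E i) + 1 * D)| <= 3 * (D / 4).
  apply: (@concentrated_type _ _ _ xi _ _ _ _ _ f) => //.
    exact: quasi_extreme_surj.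
  apply: near_form_all => x xl; have [m1 m2] := mu_avoid x xl.
  by apply: near_formI; apply: near_form_neq; [exact: m1|exact: m2].
have [l' [d' [d'0 /(_ mu)[]]]] := mu_m.
- by move=> x _; rewrite subrr normr0.
- exact: (proj1 qmu).
move=> g [gxi gE gv].
have close : pointwise_close l d zeta xi.
  by move=> x xl; rewrite zetaE// subrr normr0.
have [k [kzeta kE kv]] := type_dist_transfer i (isoxi _ close) gxi.
have := zetaP k kzeta (fun b => etrans (kE b) (gE b)).
move: gv kv; rewrite ler_norml ltr_norml ler_norml => /andP[? ?] /andP[? ?] /andP[? ?].
by lra.
Qed.

End isolated_realised.

Theorem only_realised_types_isolated_of_closure {R : realType}
    (E : completeNormedModType R) : (exists x : E, x != 0) ->
  ~ (closure (extreme_points (@dual_ball R E)) `<=` @dual_sphere R E) ->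
  only_realised_types_isolated E.
Proof.
move=> E0 /existsNP[lam /not_implyP[clam /eqP nlam]] n xi.
split; last exact: realised_isolated.
have lam1 : dominated (fun x => `|x|) (dual_form lam).
  move=> x; rewrite leNgt; apply/negP => lt.
  have [|mu [[muext _] mul]] := clam [set g : dual E | `|x| < g x].
    apply/nbhs_dual; exists [:: x], (lam x - `|x|); split=> [|g].
      by rewrite subr_gt0.
    by move=> /(_ x (mem_head _ _)); rewrite ltr_norml /= => /andP[+ _]; lra.
  by have := proj1 (dual_ballP mu) muext x; rewrite leNgt mul.
apply: (@isolated_realised _ _ E0 (dual_form lam) (dual_norm lam)).
- apply: le_trans (normr_ge0 (lam 0)) _.
  apply: (sup_upper_bound (dual_norm_has_sup lam)).
  by exists 0 => //=; rewrite normr0.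
- rewrite lt_neqAle nlam/=; exact/dual_ballP.
- exact: dual_norm_ub.
move=> P [l [d [d0 lP]]].
have [|mu [muext mul]] := clam [set g : dual E | P (dual_form g)].
  apply/nbhs_dual; exists l, d; split=> // g gl; exact: lP.
by exists (dual_form mu) => //; exact: extreme_quasi_extreme.
Qed.

(** * Sequence spaces *)

Section coordinates.
Context {R : realType} (E : normedModType R).

(** The norm at [e] is smooth along the kernel of [c], so [c] is the only
    form of norm at most 1 with value 1 at [e]; and if [c] lies inside a
    segment of the dual ball, both endpoints take the value 1 at [e]. *)
Lemma smooth_point_extreme (c : dual E) (e : E) : dual_ball c -> `|e| <= 1 ->
  c e = 1 ->
  (forall u, c u = 0 -> forall h, 0 < h ->
    exists2 t, 0 < t & `|e + t *: u| <= 1 + t * h) ->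
  extreme_points (@dual_ball R E) c.
Proof.
move=> cball e1 ce smooth; split=> // y z t yball zball /andP[t0 t1] cE.
have ball_le (g : dual E) : dual_ball g -> g e <= 1.
  by move=> /dual_ballP/(_ e) /le_trans; apply.
have eval x : c x = t * y x + (1 - t) * z x by rewrite cE.
have unique (g : dual E) : dual_ball g -> g e = 1 -> g = c.
  move=> /dual_ballP g1 ge.
  have g_le u : c u = 0 -> g u <= 0.
    move=> cu; apply/ler_addgt0Pl => h h0; rewrite addr0.
    have [s s0 es] := smooth u cu h h0.
    have := le_trans (g1 _) es.
    rewrite linearD linformZ /= ge lerD2l ler_pM2l//.
  have gker u : c u = 0 -> g u = 0.
    move=> cu; apply/eqP; rewrite eq_le g_le//= -oppr_le0.
    have <- : g (- u) = - g u by exact: (linearN (dual_form g)).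
    by apply: g_le; rewrite [c _](linearN (dual_form c)) /= cu oppr0.
  apply/val_inj/funext => x /=.
  have cx : c (x - c x *: e) = 0.
    by rewrite [c _](linearB (dual_form c)) linformZ /= ce mulr1 subrr.
  have := gker _ cx.
  rewrite [g _](linearB (dual_form g)) linformZ /= ge mulr1.
  by move/eqP; rewrite subr_eq0 => /eqP.
have ey := ball_le y yball; have ez := ball_le z zball.
have := eval e; rewrite ce => ee.
by split; apply: unique => //; nra.
Qed.

Lemma null_extreme_points (c : nat -> dual E) :
  (forall k, extreme_points (@dual_ball R E) (c k)) ->
  (forall x, (fun k => c k x) @ \oo --> 0) ->
  ~ (closure (extreme_points (@dual_ball R E)) `<=` @dual_sphere R E).
Proof.
move=> cext c0 H.
have : dual_norm (0 : dual E) = 1.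
  apply: H => U /nbhs_dual[l [d [d0 lU]]].
  suff : \forall k \near \oo, pointwise_close l d (c k) (0 : dual E).
    by move=> [k _ /(_ k (leqnn k)) ck]; exists (c k); split; [|exact: lU].
  elim: l {lU} => [|x l IH]; first by near=> k.
  have cx : \forall k \near \oo, `|c k x - (0 : dual E) x| < d.
    have /cvgrPdist_lt/(_ d d0) := c0 x.
    by apply: filterS => k; rewrite distrC.
  apply: filterS2 cx IH => k kx kl y.
  by rewrite inE => /orP[/eqP->//|]; exact: kl.
suff : dual_norm (0 : dual E) <= 0 by move=> + h; rewrite h ler10.
by apply: dual_norm_le => // x; rewrite mul0r normr0.
Unshelve. all: by end_near. Qed.

Lemma contraction_dual (f : {linear E -> R^o}) : (forall x, `|f x| <= `|x|) ->
  exists g : dual E, dual_ball g /\ (g : E -> R) =1 f.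
Proof.
move=> f1; have [x|g gf] := @dual_of_form _ E 1 f; first by rewrite mul1r.
exists g; split=> //; apply/dual_ballP => x.
by rewrite gf (le_trans (ler_norm _)).
Qed.

End coordinates.

Section c0.
Context (R : realType).

Lemma c0_coord_linear (k : nat) : linear ((fun u => u k) : c0 R -> R^o).
Proof. by []. Qed.

Lemma c0_unit_vanishing (k : nat) : (fun n => (n == k)%:R : R) \in @vanishing_seq R.
Proof.
rewrite inE /=; apply/cvgrPdist_lt => e e0; near=> n.
rewrite sub0r normrN (_ : n == k = false) ?normr0//.
by apply/negbTE; rewrite neq_ltn; apply/orP; right; near: n; exact: nbhs_infty_gt.
Unshelve. all: by end_near. Qed.

Definition c0_unit k : c0 R := C0 (c0_unit_vanishing k).

Lemma c0_closure_extreme :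
  ~ (closure (extreme_points (@dual_ball R (c0 R))) `<=` @dual_sphere R (c0 R)).
Proof.
have /choice[c cP] : forall k, exists g : dual (c0 R), dual_ball g /\
    (g : c0 R -> R) =1 linear_of (c0_coord_linear k).
  by move=> k; apply: contraction_dual => u; exact: c0_norm_ub.
apply: (@null_extreme_points _ _ c) => [k|x].
  have [cb cE] := cP k; apply: (smooth_point_extreme cb (e := c0_unit k)).
  - by apply: c0_norm_le => n /=; case: eqP; rewrite ?normr1 ?normr0.
  - by rewrite cE /= eqxx.
  move=> u; rewrite cE /= => uk h h0.
  have u0 : 0 < 1 + `|u| by rewrite ltr_pwDl.
  have t0 : 0 < (1 + `|u|)^-1 by rewrite invr_gt0.
  exists (1 + `|u|)^-1 => //; apply: (@le_trans _ _ 1); last first.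
    by rewrite lerDl mulr_ge0// ltW.
  apply: c0_norm_le => n.
  rewrite -[_ n]/((n == k)%:R + (1 + `|u|)^-1 * u n).
  have [->|nk] := eqVneq; first by rewrite uk mulr0 addr0 normr1.
  rewrite add0r normrM gtr0_norm// ler_pdivrMl// mulr1.
  by rewrite (le_trans (c0_norm_ub u n))// -[leLHS]add0r lerD2r.
under eq_fun => k do rewrite (proj2 (cP k)).
exact: (set_mem (c0_seqP x)).
Qed.

Lemma c0_neq0 : exists x : c0 R, x != 0.
Proof.
exists (c0_unit 0); apply/negP => /eqP/(congr1 (fun u : c0 R => u 0%N))/=.
by apply/eqP; rewrite oner_eq0.
Qed.

End c0.

Section lp.
Context (R : realType) (p : R) (p1 : 1 < p).
Local Notation Lp := (lp (ltW p1)).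

Lemma lp_coord_linear (k : nat) : linear ((fun u => u k) : Lp -> R^o).
Proof. by []. Qed.

Let p0 : 0 < p. Proof. exact: lt_trans p1. Qed.

Lemma unit_powR0 (j k : nat) : j != k -> `|(j == k)%:R| `^ p = 0 :> R.
Proof. by move=> /negbTE ->; rewrite normr0 powR0// gt_eqF. Qed.

Lemma sum_unit_powR (k n : nat) :
  \sum_(0 <= j < n) `|(j == k)%:R| `^ p <= 1 :> R.
Proof.
rewrite big_mkord.
have [kn|kn] := ltnP k n.
  rewrite (bigD1 (Ordinal kn))//= eqxx normr1 powR1 big1 ?addr0// => j jk.
  exact: unit_powR0.
rewrite big1 // => j _; apply: unit_powR0.
by rewrite neq_ltn (leq_trans (ltn_ord j) kn).
Qed.

Lemma lp_unit_subproof (k : nat) :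
  (fun n => (n == k)%:R : R) \in Lfun (@counting nat R) p%:E.
Proof.
rewrite inE/=; apply/andP; split; first by rewrite inE.
rewrite inE/= /finite_norm; apply: (@le_lt_trans _ _ 1%E); last exact: ltry.
apply/(Lnorm_counting_leP (ltW p1) _ ler01) => n.
by rewrite powR1 sum_unit_powR.
Qed.

Definition lp_unit k : Lp := Lfun_Sub (ltW p1 : (1 <= p%:E)%E) (lp_unit_subproof k).

Lemma lp_norm_unitD k (u : Lp) (t : R) : u k = 0 -> 0 <= t ->
  `|lp_unit k + t *: u| <= 1 + t `^ p * `|u| `^ p.
Proof.
move=> uk t0.
have K1 : 1 <= 1 + t `^ p * `|u| `^ p by rewrite lerDl mulr_ge0// powR_ge0.
have K0 : 0 <= 1 + t `^ p * `|u| `^ p by apply: le_trans K1.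
apply/(lp_norm_leP _ K0) => n.
apply: (@le_trans _ _ (1 + t `^ p * `|u| `^ p)); last first.
  rewrite -[leLHS]powRr1//; exact: ler_powR (ltW p1).
have -> : \sum_(0 <= j < n) `|(lp_unit k + t *: u) j| `^ p =
    \sum_(0 <= j < n) `|(j == k)%:R| `^ p +
    t `^ p * \sum_(0 <= j < n) `|u j| `^ p.
  rewrite mulr_sumr -big_split/=; apply: eq_bigr => j _.
  rewrite -[(_ + _) j]/((j == k)%:R + t * u j).
  have [->|jk] := eqVneq.
    by rewrite uk mulr0 addr0 normr0 powR0 ?gt_eqF// mulr0 addr0.
  rewrite add0r normr0 powR0 ?gt_eqF// add0r normrM powRM// ger0_norm//.
rewrite lerD ?sum_unit_powR// ler_wpM2l ?powR_ge0//.
have /(lp_norm_leP u (lp_norm_ge0 u))/(_ n) := lexx (lp_norm u).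
exact.
Qed.

(** Here [p > 1] is essential: the deviation is of order [t ^ p], which is
    [o(t)]. *)
Lemma lp_unit_smooth k (u : Lp) : u k = 0 -> forall h, 0 < h ->
  exists2 t, 0 < t & `|lp_unit k + t *: u| <= 1 + t * h.
Proof.
move=> uk h h0; pose K := `|u| `^ p + 1.
have K0 : 0 < K by rewrite ltr_wpDl// powR_ge0.
pose t := (h / K) `^ (p - 1)^-1.
have t0 : 0 < t by rewrite powR_gt0// divr_gt0.
exists t => //; apply: (le_trans (lp_norm_unitD uk (ltW t0))).
rewrite lerD2l.
have tp : t `^ p = t * (h / K).
  rewrite -[in LHS](subrKC 1 p) powRD ?powRr1 ?(ltW t0)//; last first.
    by rewrite (gt_eqF t0) implybT.
  congr (_ * _); rewrite -powRrM mulVf ?powRr1//; first by rewrite ltW// divr_gt0.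
  by rewrite subr_eq0 gt_eqF.
rewrite tp -mulrA ler_pM2l// -mulrA -[leRHS]mulr1 ler_pM2l//.
by rewrite ler_pdivrMl// mulr1 /K lerDl.
Qed.

Lemma lp_coord_cvg0 (u : Lp) : (fun k => u k) @ \oo --> 0.
Proof.
have cs : cvgn (series (fun k => `|u k| `^ p)).
  apply: nondecreasing_is_cvgn.
    by apply: nondecreasing_series => k _ _; exact: powR_ge0.
  exists (`|u| `^ p) => _ [n _ <-].
  by have /(lp_norm_leP u (lp_norm_ge0 u))/(_ n) := lexx (lp_norm u).
apply/cvgrPdist_lt => e e0; rewrite /=.
have /cvgrPdist_lt/(_ (e `^ p)) := cvg_series_cvg_0 cs.
rewrite powR_gt0// => /(_ isT); apply: filterS => k.
rewrite !sub0r !normrN ger0_norm ?powR_ge0//.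
rewrite !ltNge; apply: contra => ek.
by apply: ge0_ler_powR => //; rewrite ?nnegrE ltW.
Qed.

Lemma lp_closure_extreme :
  ~ (closure (extreme_points (@dual_ball R Lp)) `<=` @dual_sphere R Lp).
Proof.
have /choice[c cP] : forall k, exists g : dual Lp, dual_ball g /\
    (g : Lp -> R) =1 linear_of (lp_coord_linear k).
  by move=> k; apply: contraction_dual => u; exact: lp_norm_ub.
apply: (@null_extreme_points _ _ c) => [k|x].
  have [cb cE] := cP k; apply: (smooth_point_extreme cb (e := lp_unit k)).
  - apply/(lp_norm_leP _ ler01) => n; rewrite powR1; exact: sum_unit_powR.
  - by rewrite cE /= eqxx.
  by move=> u; rewrite cE /= => uk h h0; exact: lp_unit_smooth.
under eq_fun => k do rewrite (proj2 (cP k)).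
exact: lp_coord_cvg0.
Qed.

Lemma lp_neq0 : exists x : Lp, x != 0.
Proof.
exists (lp_unit 0); apply/negP => /eqP/(congr1 (fun u : Lp => u 0%N))/=.
by apply/eqP; rewrite oner_eq0.
Qed.

End lp.

Theorem proposition6p7 (R : realType) :
  (forall E : completeNormedModType R, (exists x : E, x != 0) ->
    ~ (closure (extreme_points (@dual_ball R E)) `<=` @dual_sphere R E) ->
    only_realised_types_isolated E) /\
  (~ (closure (extreme_points (@dual_ball R (c0 R))) `<=` @dual_sphere R (c0 R)) /\
    only_realised_types_isolated (c0 R)) /\
  (forall (p : R) (p1 : 1 < p),
    ~ (closure (extreme_points (@dual_ball R (lp (ltW p1))))
         `<=` @dual_sphere R (lp (ltW p1))) /\
    only_realised_types_isolated (lp (ltW p1))).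
Proof.
split; first exact: only_realised_types_isolated_of_closure.
split=> [|p p1].
  split; first exact: c0_closure_extreme.
  apply: only_realised_types_isolated_of_closure; first exact: c0_neq0.
  exact: c0_closure_extreme.
split; first exact: lp_closure_extreme.
apply: only_realised_types_isolated_of_closure; first exact: lp_neq0.
exact: lp_closure_extreme.
Qed.
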